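(* Let $(T,F)$ be a Deligne module over $k=\mathbb F_q$, $q=p^a$, with a polarization $\omega$ and a real structure $\tau$ compatible with $\omega$. Let $\omega_p$ be the resulting symplectic form on the covariant Dieudonn\'e module $M(T)\subset T\otimes W(\bar k)$. Then the mapping $\tau_p:T\otimes W(\bar k)\to T\otimes W(\bar k)$ defined by $\tau_p(x\otimes w)=\tau(x)\otimes\bar\tau(w)$ is continuous and $W(k)$-linear. It preserves the Dieudonn\'e module $M(T)$, it satisfies $\tau_p\mathcal F^a=\mathcal V^a\tau_p$, and $\omega_p(\tau_px,\tau_py)=-\omega_p(x,y)$ for all $x,y\in M(T)$.
   Context: A Deligne module of rank $2n$ over $\mathbb F_q$ is a pair $(T,F)$, $T\cong\mathbb Z^{2n}$, $F\in\mathrm{End}(T)$ semisimple with all complex eigenvalues of absolute value $\sqrt q$; exactly half of its eigenvalues in $\overline{\mathbb Q}_p$ are $p$-adic units and half are divisible by $q$; the middle coefficient of its characteristic polynomial is coprime to $p$; and there is $V\in\mathrm{End}(T)$ with $FV=VF=q$. Fix an embedding $\varepsilon:W(\bar k)\to\mathbb C$; it determines a valuation $\mathrm{val}_p$ on $\overline{\mathbb Q}\subset\mathbb C$, and the CM type $\Phi_\varepsilon$ on $\mathbb Q[F]$ is the set of $\phi:\mathbb Q[F]\to\mathbb C$ with $\mathrm{val}_p(\phi(F))>0$. A polarization is an alternating $\omega:T\times T\to\mathbb Z$, nondegenerate over $\mathbb Q$, with $\omega(Fx,y)=\omega(x,Vy)$ and with $\omega(x,\iota y)$ symmetric positive definite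 for $\iota\in\mathbb Q[F]$ such that $\bar\iota=-\iota$ and $\phi(\iota)$ is positive imaginary for all $\phi\in\Phi_\varepsilon$. A compatible real structure is $\tau:T\to T$ with $\tau^2=I$, $\tau F\tau^{-1}=V$, $\omega(\tau x,\tau y)=-\omega(x,y)$. There is a unique decomposition $T\otimes\mathbb Z_p=T'\oplus T''$ preserved by $F$ with $F$ invertible on $T'$ and divisible by $q$ on $T''$. Let $\sigma$ be the lift to $W(\bar k)$ of $x\mapsto x^p$. The topological generator $\pi$ of $\mathrm{Gal}(\bar k/k)$ acts on $T\otimes W(\bar k)$ by $\pi(t'\otimes w)=F(t')\otimes\sigma^a(w)$ and $\pi(t''\otimes w)=q^{-1}F(t'')\otimes\sigma^a(w)$ for $t'\in T'$, $t''\in T''$, and $M(T)=(T\otimes W(\bar k))^{\mathrm{Gal}}$. The operators are $\mathcal F(t'\otimes w)=pt'\otimes\sigma(w)$, $\mathcal F(t''\otimes w)=t''\otimes\sigma(w)$, $\mathcal V(t'\otimes w)=t'\otimes\sigma^{-1}(w)$, $\mathcal V(t''\otimes w)=pt''\otimes\sigma^{-1}(w)$. The form $\omega_p:M(T)\times M(T)\to W(k)$ is the restriction of the $W(\bar k)$-bilinear extension of $\omega$. $\bar\tau:W(\bar k)\to W(\bar k)$ is a fixed continuous $W(k)$-linear involution with $\bar\tau\sigma^a=\sigma^{-a}\bar\tau$, preserving $W(E)$ for every finite extension $E/k$ and commuting with the traces $W(L)\to W(E)$ for finite extensions $L\supset E\supset k$. *)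

(* Defs.v *)
From HB Require Import structures.
From mathcomp Require Import all_boot all_order all_algebra.
From mathcomp Require Import finmap ring.
From mathcomp Require Import all_classical all_reals.
From mathcomp Require Import complex.
From mathcomp Require monalg.
Import -(notations) monalg.

Set Implicit Arguments.
Unset Strict Implicit.
Unset Printing Implicit Defensive.

Import Order.TTheory GRing.Theory Num.Theory.
Local Open Scope ring_scope.

(* The polynomial ring Z[X_(j,i)] in countably many variables; X_(j,i) plays the
   role of the i-th coordinate of the j-th argument of a Witt vector operation. *)
Local Notation vpoly := (malg (cmonom (nat * nat)%type) int).
HB.lock Definition vvar (i : nat * nat) : vpoly := mkmalgU (ucm i) 1.

Section Eval.
Variables (S : comNzRingType) (v : nat * nat -> S).
Definition evalm (m : cmonom (nat * nat)%type) : S :=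
  \prod_(i <- finsupp m) v i ^+ m i.

Lemma evalmw (d : seq (nat * nat)) (m : cmonom (nat * nat)%type) :
  uniq d -> {subset finsupp m <= d} -> evalm m = \prod_(i <- d) v i ^+ m i.
Proof.
move=> ud sd; rewrite /evalm.
rewrite [RHS](bigID (mem (finsupp m))) /= [X in _ * X]big1 ?mulr1; last first.
  by move=> i; rewrite -cmE_neq0 negbK => /eqP ->; rewrite expr0.
rewrite -[RHS]big_filter; apply: perm_big; apply: uniq_perm.
- exact: finmap.fset_uniq.
- exact: filter_uniq.
move=> i; rewrite mem_filter; case: (boolP (i \in finsupp m)) => // h.
by rewrite (sd _ h) andbT; apply/esym.
Qed.

Lemma evalm_mmorph : mmorphism evalm.
Proof.
split => [m1 m2|]; last first.
  by rewrite /evalm mdom1 big_nil.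
set d := undup (finsupp m1 ++ finsupp m2).
rewrite !(@evalmw d) ?undup_uniq //.
- by rewrite -big_split /=; apply: eq_bigr => i _; rewrite cmM exprD.
- by move=> i h; rewrite mem_undup mem_cat h orbT.
- by move=> i h; rewrite mem_undup mem_cat h.
- move=> i; rewrite mem_undup mem_cat -!cmE_neq0 cmM addn_eq0 negb_and; exact.
Qed.
HB.instance Definition _ := isMultiplicative.Build _ S evalm evalm_mmorph.

Definition veval : vpoly -> S := mmap (intr : int -> S) evalm.
HB.instance Definition _ := GRing.RMorphism.on veval.

Lemma veval_var i : veval (vvar i) = v i.
Proof.
rewrite /veval vvar.unlock mmapU /= mulr1z mul1r /evalm mdomU.
by rewrite finmap.big_seq_fset1 cmUU expr1.
Qed.
End Eval.

Lemma vmon_ind (P : vpoly -> Prop) :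
  P 1 -> (forall i, P (vvar i)) ->
  (forall a b, P a -> P b -> P (a * b)) -> forall k, P (mkmalgU k 1).
Proof.
move=> P1 PX PM k; have [N] := ubnP (mdeg k).
elim: N k => [k h|N IH m hm]; first by exfalso; move: h; rewrite ltn0.
case: (posnP (mdeg m)) => [/mdeg_eq0I ->|]; first exact: P1.
rewrite lt0n => m0.
have [i mi] : exists i, m i != 0%N.
  have : m != onecm _ by apply: contra m0 => /eqP ->; rewrite mdeg1.
  move=> /negP hm1; apply: contrapT => /forallNP hi; apply: hm1; apply/cmP => i.
  by rewrite onecmE; apply/eqP; move: (hi i); case: eqP.
have mE : m = mulcm (ucm i) (divcm m (ucm i)).
  apply/eqP/cmP => j; rewrite mulcmE divcmE subnKC // ucmE.
  by case: eqP => // <-; rewrite lt0n.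
have -> : (mkmalgU m 1 : vpoly) = vvar i * mkmalgU (divcm m (ucm i)) 1.
  by rewrite {1}mE vvar.unlock malgM_def fgmulUU mulr1.
apply: PM; [exact: PX|apply: IH].
by move: hm; rewrite {1}mE ltnS (mdegM (ucm i)) mdegU add1n.
Qed.

Lemma vpoly_ind (P : vpoly -> Prop) :
  P 1 -> (forall i, P (vvar i)) -> (forall a b, P a -> P b -> P (a - b)) ->
  (forall a b, P a -> P b -> P (a * b)) -> forall a, P a.
Proof.
move=> P1 PX PB PM a.
have P0 : P 0 by rewrite -(subrr 1); exact: PB.
have PN b : P b -> P (- b) by move=> h; rewrite -[- b]add0r; exact: PB.
have PD b c : P b -> P c -> P (b + c).
  by move=> hb hc; rewrite -[c]opprK; apply: PB => //; apply: PN.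
have Ea := monalgE a.
rewrite Ea.
apply: (big_ind P).
- exact: P0.
- exact: PD.
move=> k _.
have -> : mkmalgU k (mcoeff k a) = (mkmalgU k 1 : vpoly) *~ (mcoeff k a).
  by rewrite -(raddfMz (mkmalgU k : int -> vpoly)) /= intz.
have PMn b n : P b -> P (b *+ n).
  by move=> hb; elim: n => [|n IH]; rewrite ?mulr0n // mulrS; apply: PD.
suff Pk : P (mkmalgU k 1).
  by case: (mcoeff k a) => n /=; rewrite ?pmulrn ?NegzE ?mulrNz -?pmulrn; [|apply: PN]; exact: PMn.
exact: vmon_ind.
Qed.

Lemma vpoly_ext (S : comNzRingType) (f g : {rmorphism vpoly -> S}) :
  (forall i, f (vvar i) = g (vvar i)) -> f =1 g.
Proof.
move=> h; apply: vpoly_ind => //.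
- by rewrite !rmorph1.
- by move=> a b ha hb; rewrite !rmorphB ha hb.
- by move=> a b ha hb; rewrite !rmorphM ha hb.
Qed.

Lemma vpoly_torsfree (a b : vpoly) n : (0 < n)%N -> a *+ n = b *+ n -> a = b.
Proof.
move=> n0 /malgP h; apply/malgP => k; move: (h k); rewrite !mcoeffMn.
move/eqP; rewrite eqrMn2r. case: n n0 {h} => // n _ /=. by move/eqP.
Qed.

Section Ghost.
Variables (p : nat) (R : comNzRingType).

Definition ghost (x : nat -> R) (n : nat) : R :=
  \sum_(i < n.+1) x i ^+ (p ^ (n - i)) *+ p ^ i.

Definition ghost_low (x : nat -> R) (n : nat) : R :=
  \sum_(i < n) x i ^+ (p ^ (n - i)) *+ p ^ i.

Lemma ghostE x n : ghost x n = ghost_low x n + x n *+ p ^ n.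
Proof. by rewrite /ghost big_ord_recr /= subnn expr1. Qed.

(* A solution b of m b = a. *)
Definition quo (m : nat) (a : R) : R := xget 0 [set b | b *+ m = a]%classic.

(* unghost a is the sequence whose ghost components are a, defined by
   x_n = (a_n - sum_(i < n) p^i x_i^(p^(n-i))) / p^n; it exists under Dwork's
   congruences (unghostK). *)
Fixpoint unghost_seq (a : nat -> R) (n : nat) : seq R :=
  if n is n'.+1 then
    let s := unghost_seq a n' in
    rcons s (quo (p ^ n') (a n' - ghost_low (nth 0 s) n'))
  else [::].

Definition unghost (a : nat -> R) (n : nat) : R := nth 0 (unghost_seq a n.+1) n.

Lemma size_unghost_seq a n : size (unghost_seq a n) = n.
Proof. by elim: n => //= n IH; rewrite size_rcons IH. Qed.

Lemma nth_unghost_seq a n i : (i < n)%N -> nth 0 (unghost_seq a n) i = unghost a i.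
Proof.
elim: n => // n IH; rewrite ltnS leq_eqVlt => /predU1P[->|ltin] //.
by rewrite /= nth_rcons size_unghost_seq ltin IH.
Qed.

Lemma eq_ghost_low x y n : (forall i, (i < n)%N -> x i = y i) ->
  ghost_low x n = ghost_low y n.
Proof. by move=> h; apply: eq_bigr => i _; rewrite h. Qed.

Lemma unghostE a n :
  unghost a n = quo (p ^ n) (a n - ghost_low (unghost a) n).
Proof.
rewrite /unghost /= nth_rcons size_unghost_seq ltnn eqxx.
congr (quo _ (_ - _)); apply: eq_ghost_low => i lti; exact: nth_unghost_seq.
Qed.

Lemma quoP m a : (exists b, b *+ m = a) -> quo m a *+ m = a.
Proof. by move=> [b hb]; exact: (@xgetPex _ 0 [set b | b *+ m = a]%classic (ex_intro _ b hb)). Qed.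

Definition mdvd (m : nat) (a : R) := exists b, b *+ m = a.

Lemma mdvd0 m : mdvd m 0. Proof. by exists 0; rewrite mul0rn. Qed.
Lemma mdvdD m a b : mdvd m a -> mdvd m b -> mdvd m (a + b).
Proof. by move=> [x <-] [y <-]; exists (x + y); rewrite mulrnDl. Qed.
Lemma mdvdN m a : mdvd m a -> mdvd m (- a).
Proof. by move=> [x <-]; exists (- x); rewrite mulNrn. Qed.
Lemma mdvdM m a b : mdvd m a -> mdvd m (b * a).
Proof. by move=> [x <-]; exists (b * x); rewrite mulrnAr. Qed.
Lemma mdvdMn m k a : mdvd m a -> mdvd (m * k) (a *+ k).
Proof. by move=> [x <-]; exists x; rewrite mulrnA. Qed.

Lemma mdvd_sum m n (F : 'I_n -> R) : (forall i, mdvd m (F i)) -> mdvd m (\sum_i F i).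
Proof.
move=> h; elim/big_ind : _ => //; [exact: mdvd0|exact: mdvdD].
Qed.

Hypothesis p_pr : prime p.

Lemma mdvd_exp_sub m (a b : R) : mdvd m.+1 (a - b) -> (p %| m.+1)%N ->
  mdvd (m.+1 * p) (a ^+ p - b ^+ p).
Proof.
move=> [x hx] pm; have -> : a = b + x *+ m.+1 by rewrite hx addrC subrK.
rewrite exprDn; have := prime_gt1 p_pr; case: p pm p_pr => // -[//|q] pm q_pr _.
rewrite 2!big_ord_recl /= /bump /= addn0 subn0 expr0 mulr1 bin0 mulr1n.
rewrite [b ^+ _ + _]addrC addrK subSS subn0 expr1 bin1; apply: mdvdD.
  by exists (b ^+ q.+1 * x); rewrite mulrnAr mulrnA.
apply: mdvd_sum => i; rewrite /= /bump !add1n exprMn_n mulrnAr.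
have /dvdnP[c ->] : (m.+1 * q.+2 %| m.+1 ^ i.+2)%N.
  by rewrite !expnS dvdn_mul // dvdn_mulr.
exists (b ^+ (q.+2 - i.+2) * x ^+ i.+2 *+ (c * 'C(q.+2, i.+2))).
by rewrite -!mulrnA; congr (_ *+ _); rewrite mulnAC.
Qed.

Lemma mdvd_exp_add (a b : R) : mdvd p ((a + b) ^+ p - (a ^+ p + b ^+ p)).
Proof.
rewrite exprDn; case: p p_pr => // q q_pr.
rewrite big_ord_recl big_ord_recr /= /bump subn0 expr0 mulr1 add1n subnn expr0.
rewrite mul1r bin0 binn !mulr1n.
set s := \sum_(i < q) _; have -> : a ^+ q.+1 + (s + b ^+ q.+1) - (a ^+ q.+1 + b ^+ q.+1) = s.
  by ring.
apply: mdvd_sum => i; have /dvdnP[c ->] : (q.+1 %| 'C(q.+1, 1 + i))%N.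
  by apply: prime_dvd_bin => //; rewrite add1n /= ltnS ltn_ord.
by rewrite mulrnA; exists (a ^+ (q.+1 - (1 + i)) * b ^+ (1 + i) *+ c).
Qed.

Lemma lift_sub (a b a' b' : R) : mdvd p (a' - a ^+ p) -> mdvd p (b' - b ^+ p) ->
  mdvd p (a' - b' - (a - b) ^+ p).
Proof.
move=> ha hb.
have -> : a' - b' - (a - b) ^+ p = (a' - a ^+ p)
   - (b' - b ^+ p) + (((a - b) + b) ^+ p - ((a - b) ^+ p + b ^+ p)).
  by rewrite subrK; ring.
by apply: mdvdD; [apply: mdvdD => //; exact: mdvdN|exact: mdvd_exp_add].
Qed.

Lemma mdvd_mul m (a b a' b' : R) : mdvd m (a' - a) -> mdvd m (b' - b) ->
  mdvd m (a' * b' - a * b).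
Proof.
move=> ha hb; have -> : a' * b' - a * b = b' * (a' - a) + a * (b' - b) by ring.
by apply: mdvdD; exact: mdvdM.
Qed.

Lemma mdvd_exp_subX k (a b : R) : mdvd p (a - b) ->
  mdvd (p ^ k.+1) (a ^+ (p ^ k) - b ^+ (p ^ k)).
Proof.
move=> h; elim: k => [|k IH]; first by rewrite expn1 !expr1.
rewrite expnSr [(p ^ k.+1)%N]expnSr !exprM.
have p0 := prime_gt0 p_pr.
have : (0 < p ^ k * p)%N by rewrite muln_gt0 expn_gt0 p0.
move: IH; rewrite expnSr; case E : (p ^ k * p)%N => [//|m] IH _.
by apply: mdvd_exp_sub => //; rewrite -E dvdn_mull.
Qed.

Variable phi : {rmorphism R -> R}.
Hypothesis phi_lift : forall a, mdvd p (phi a - a ^+ p).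

Lemma dworkD m a b a' b' : mdvd m (a' - phi a) -> mdvd m (b' - phi b) ->
  mdvd m (a' + b' - phi (a + b)).
Proof. by move=> ha hb; rewrite rmorphD opprD addrACA; exact: mdvdD. Qed.

Lemma dworkN m a a' : mdvd m (a' - phi a) -> mdvd m (- a' - phi (- a)).
Proof. by move=> ha; rewrite rmorphN -opprD; exact: mdvdN. Qed.

Lemma dworkM m a b a' b' : mdvd m (a' - phi a) -> mdvd m (b' - phi b) ->
  mdvd m (a' * b' - phi (a * b)).
Proof. by move=> ha hb; rewrite rmorphM; exact: mdvd_mul. Qed.

Lemma unghostK (a : nat -> R) :
  (forall n, mdvd (p ^ n.+1) (a n.+1 - phi (a n))) ->
  forall n, ghost (unghost a) n = a n.
Proof.
move=> ha n; rewrite ghostE unghostE.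
suff h : mdvd (p ^ n) (a n - ghost_low (unghost a) n).
  by rewrite quoP // addrC subrK.
elim: n => [|n IH]; first by rewrite expn0; exists (a 0 - ghost_low (unghost a) 0).
have E : ghost (unghost a) n = a n.
  by rewrite ghostE unghostE quoP // addrC subrK.
rewrite -[a n.+1](subrK (phi (a n))) -addrA; apply: mdvdD => //.
rewrite -{1}E /ghost /ghost_low rmorph_sum -sumrB; apply: mdvd_sum => i.
rewrite rmorphMn rmorphXn -mulrnBl /=.
have lei : (i <= n)%N by rewrite -ltnS.
have -> : (p ^ n.+1 = p ^ (n - i).+1 * p ^ i)%N by rewrite -expnD addSn subnK.
apply: mdvdMn; rewrite subSn // [(p ^ (n - i).+1)%N in X in _ - X]expnS exprM.
exact: mdvd_exp_subX.
Qed.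
End Ghost.

Lemma ghost_map p (R S : comNzRingType) (f : {rmorphism R -> S}) x n :
  f (ghost p x n) = ghost p (f \o x) n.
Proof. by rewrite rmorph_sum; apply: eq_bigr => i _; rewrite rmorphMn rmorphXn. Qed.

Lemma ghost_inj p (R : comNzRingType) : (0 < p)%N ->
  (forall (a b : R) n, (0 < n)%N -> a *+ n = b *+ n -> a = b) ->
  forall x y : nat -> R, ghost p x =1 ghost p y -> x =1 y.
Proof.
move=> p0 tf x y h n; have [N] := ubnP n; elim: N n => // N IH n.
rewrite ltnS => leN; have := h n; rewrite !ghostE (@eq_ghost_low _ _ x y) => [/addrI|].
  by apply: tf; rewrite expn_gt0 p0.
by move=> i ltin; apply: IH; apply: leq_trans leN.
Qed.

Lemma phi_ghost p (R : comNzRingType) (phi : {rmorphism R -> R}) x n :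
  (forall i, phi (x i) = x i ^+ p) ->
  mdvd (p ^ n.+1) (ghost p x n.+1 - phi (ghost p x n)).
Proof.
move=> h; rewrite ghostE; exists (x n.+1); rewrite addrAC -[LHS]add0r; congr (_ + _).
apply/esym/eqP; rewrite subr_eq0; apply/eqP.
rewrite rmorph_sum; apply: eq_bigr => i _.
rewrite rmorphMn rmorphXn /= h -exprM -expnS subSn //; by rewrite -ltnS.
Qed.

(* The lift of Frobenius X_(j,i) |-> X_(j,i)^p of the polynomial ring *)
Definition vphi p : vpoly -> vpoly := veval (fun i => vvar i ^+ p).
HB.instance Definition _ p := GRing.RMorphism.on (vphi p).

Lemma vphi_lift p : prime p -> forall a : vpoly, mdvd p (vphi p a - a ^+ p).
Proof.
move=> pp; apply: vpoly_ind.
- by rewrite rmorph1 expr1n subrr; exact: mdvd0.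
- by move=> i; rewrite /vphi veval_var subrr; exact: mdvd0.
- move=> a b ha hb; rewrite rmorphB.
  exact: (lift_sub pp ha hb).
- move=> a b ha hb; rewrite rmorphM exprMn.
  exact: (mdvd_mul ha hb).
Qed.

Definition genv (j i : nat) : vpoly := vvar (j, i).

Section VevalMorph.
Variables (R : comNzRingType) (v : nat * nat -> R).
Lemma vevalD a b : veval v (a + b) = veval v a + veval v b.
Proof. exact: (rmorphD (veval v)). Qed.
Lemma vevalM a b : veval v (a * b) = veval v a * veval v b.
Proof. exact: (rmorphM (veval v)). Qed.
Lemma vevalN a : veval v (- a) = - veval v a.
Proof. exact: (rmorphN (veval v)). Qed.
End VevalMorph.

Definition pairv (R : Type) (x y : nat -> R) (ji : nat * nat) : R :=
  if ji.1 == 0%N then x ji.2 else y ji.2.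

HB.lock Definition wop (S : nat -> vpoly) (R : comNzRingType) (x y : nat -> R) (n : nat) : R :=
  veval (pairv x y) (S n).

(* The universal polynomials of Witt vector addition, multiplication and
   opposite, which are determined by their ghost components. *)
HB.lock Definition add_poly p := unghost p (fun n => ghost p (genv 0) n + ghost p (genv 1) n).
HB.lock Definition mul_poly p := unghost p (fun n => ghost p (genv 0) n * ghost p (genv 1) n).
HB.lock Definition opp_poly p := unghost p (fun n => - ghost p (genv 0) n).

HB.lock Definition gzero (R : comNzRingType) (n : nat) : R := 0.
HB.lock Definition gone (R : comNzRingType) (n : nat) : R := (n == 0%N)%:R.

Section WittLaws.
Variables (p : nat) (p_pr : prime p).

Lemma ghost_genv n : mdvd (p ^ n.+1) (ghost p (genv 0) n.+1 - vphi p (ghost p (genv 0) n))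
  /\ mdvd (p ^ n.+1) (ghost p (genv 1) n.+1 - vphi p (ghost p (genv 1) n)).
Proof. by split; apply: phi_ghost => i; exact: veval_var. Qed.

Lemma ghost_add_poly n :
  ghost p (add_poly p) n = ghost p (genv 0) n + ghost p (genv 1) n.
Proof.
rewrite add_poly.unlock; apply: (unghostK p_pr (vphi_lift p_pr)) => m; have [h0 h1] := ghost_genv m.
exact: (dworkD h0 h1).
Qed.

Lemma ghost_opp_poly n : ghost p (opp_poly p) n = - ghost p (genv 0) n.
Proof.
rewrite opp_poly.unlock; apply: (unghostK p_pr (vphi_lift p_pr)) => m; have [h0 _] := ghost_genv m.
exact: (dworkN h0).
Qed.

Lemma ghost_mul_poly n :
  ghost p (mul_poly p) n = ghost p (genv 0) n * ghost p (genv 1) n.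
Proof.
rewrite mul_poly.unlock; apply: (unghostK p_pr (vphi_lift p_pr)) => m; have [h0 h1] := ghost_genv m.
exact: (dworkM h0 h1).
Qed.

Lemma ghost_wop S (R : comNzRingType) (x y : nat -> R) n :
  ghost p (wop S x y) n =
  veval (pairv x y) (ghost p S n).
Proof. by rewrite ghost_map; congr ghost; apply: funext => i; rewrite wop.unlock. Qed.

Lemma veval_ghost_genv (R : comNzRingType) v j n :
  veval v (ghost p (genv j) n) = ghost p (fun i => v (j, i)) n :> R.
Proof.
rewrite ghost_map; congr ghost; apply: funext => i /=; exact: veval_var.
Qed.

Section GhostOps.
Variables (R : comNzRingType) (x y : nat -> R) (n : nat).

Lemma ghost_wadd : ghost p (wop (add_poly p) x y) n = ghost p x n + ghost p y n.
Proof.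
rewrite ghost_wop ghost_add_poly vevalD.
exact: (congr2 +%R (veval_ghost_genv (pairv x y) 0 n) (veval_ghost_genv (pairv x y) 1 n)).
Qed.

Lemma ghost_wmul : ghost p (wop (mul_poly p) x y) n = ghost p x n * ghost p y n.
Proof.
rewrite ghost_wop ghost_mul_poly vevalM.
exact: (congr2 *%R (veval_ghost_genv (pairv x y) 0 n) (veval_ghost_genv (pairv x y) 1 n)).
Qed.

Lemma ghost_wopp : ghost p (wop (opp_poly p) x y) n = - ghost p x n.
Proof.
rewrite ghost_wop ghost_opp_poly vevalN.
exact: (congr1 -%R (veval_ghost_genv (pairv x y) 0 n)).
Qed.
End GhostOps.

Lemma ghost_gzero (R : comNzRingType) n : ghost p (@gzero R) n = 0.
Proof.
rewrite /ghost big1 // => i _; rewrite gzero.unlock expr0n.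
by rewrite expn_eq0 (gtn_eqF (prime_gt0 p_pr)) /= mul0rn.
Qed.

Lemma ghost_gone (R : comNzRingType) n : ghost p (@gone R) n = 1.
Proof.
rewrite /ghost big_ord_recl /= {1}gone.unlock expr1n expn0 mulr1n big1 ?addr0 // => i _.
by rewrite gone.unlock expr0n expn_eq0 (gtn_eqF (prime_gt0 p_pr)) /= mul0rn.
Qed.

Lemma wop_map S (R R' : comNzRingType) (f : {rmorphism R -> R'}) (x y : nat -> R) :
  wop S (f \o x) (f \o y) = f \o wop S x y.
Proof.
apply: funext => n; rewrite /= wop.unlock; set v := (X in f (veval X _)).
rewrite -[RHS]/((f \o veval v) (S n)); apply: vpoly_ext => i /=.
by rewrite !veval_var /v /pairv; case: ifP.
Qed.

Lemma map_gzero (R R' : comNzRingType) (f : {rmorphism R -> R'}) : f \o @gzero R = @gzero R'.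
Proof. by apply: funext => n /=; rewrite !gzero.unlock rmorph0. Qed.
Lemma map_gone (R R' : comNzRingType) (f : {rmorphism R -> R'}) : f \o @gone R = @gone R'.
Proof. by apply: funext => n /=; rewrite !gone.unlock rmorph_nat. Qed.

Lemma gen_vec (R : comNzRingType) (x y z : nat -> R) :
  exists f : {rmorphism vpoly -> R},
    [/\ x = f \o genv 0, y = f \o genv 1 & z = f \o genv 2].
Proof.
exists (veval (fun ji => if ji.1 == 0%N then x ji.2 else if ji.1 == 1%N then y ji.2 else z ji.2)).
by split; apply: funext => i /=; rewrite /genv veval_var.
Qed.

Lemma vpoly_ghost_inj (x y : nat -> vpoly) : ghost p x =1 ghost p y -> x = y.
Proof.
move=> h; apply: funext; apply: (ghost_inj (prime_gt0 p_pr) _ h).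
exact: vpoly_torsfree.
Qed.

Variable R : comNzRingType.
Implicit Types x y z : nat -> R.
Local Notation add := (wop (add_poly p)).
Local Notation mul := (wop (mul_poly p)).
Local Notation opp x := (wop (opp_poly p) x x).

Local Ltac universal x y z :=
  let f := fresh "f" in
  have [f [-> -> ->]] := gen_vec x y z;
  rewrite -?(map_gzero f) -?(map_gone f) !wop_map; congr (_ \o _);
  apply: vpoly_ghost_inj => n;
  rewrite !(ghost_wadd, ghost_wmul, ghost_wopp, ghost_gzero, ghost_gone).

Lemma gaddA x y z : add x (add y z) = add (add x y) z.
Proof. universal x y z; exact: addrA. Qed.
Lemma gaddC x y : add x y = add y x.
Proof. universal x y x; exact: addrC. Qed.
Lemma gadd0 x : add (@gzero R) x = x.
Proof. universal x x x; exact: add0r. Qed.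
Lemma gaddN x : add (opp x) x = @gzero R.
Proof. universal x x x; exact: addNr. Qed.
Lemma gmulA x y z : mul x (mul y z) = mul (mul x y) z.
Proof. universal x y z; exact: mulrA. Qed.
Lemma gmulC x y : mul x y = mul y x.
Proof. universal x y x; exact: mulrC. Qed.
Lemma gmul1 x : mul (@gone R) x = x.
Proof. universal x x x; exact: mul1r. Qed.
Lemma gmulDl x y z : mul (add x y) z = add (mul x z) (mul y z).
Proof. universal x y z; exact: mulrDl. Qed.
End WittLaws.

(* The p-typical Witt vectors over R; p_pr only serves to build the ring structure. *)
Record witt (p : nat) (p_pr : prime p) (R : Type) := Witt { wcoord : nat -> R }.

Section WittRing.
Variables (p : nat) (p_pr : prime p) (R : comNzRingType).
Local Notation W := (witt p_pr R).
Implicit Types x y z : W.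

HB.instance Definition _ := gen_eqMixin W.
HB.instance Definition _ := gen_choiceMixin W.

Lemma wittP x y : wcoord x =1 wcoord y -> x = y.
Proof. by case: x y => x [y] h; congr Witt; exact: funext. Qed.

Definition wadd x y : W := Witt p_pr (wop (add_poly p) (wcoord x) (wcoord y)).
Definition wmul x y : W := Witt p_pr (wop (mul_poly p) (wcoord x) (wcoord y)).
Definition wopp x : W := Witt p_pr (wop (opp_poly p) (wcoord x) (wcoord x)).
Definition wzero : W := Witt p_pr (@gzero R).
Definition wone : W := Witt p_pr (@gone R).

Lemma waddA : associative wadd.
Proof. by move=> x y z; congr Witt; exact: gaddA. Qed.
Lemma waddC : commutative wadd.
Proof. by move=> x y; congr Witt; exact: gaddC. Qed.
Lemma wadd0 : left_id wzero wadd.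
Proof. by move=> [x]; congr Witt; exact: gadd0. Qed.
Lemma waddN : left_inverse wzero wopp wadd.
Proof. by move=> x; congr Witt; exact: gaddN. Qed.
Lemma wmulA : associative wmul.
Proof. by move=> x y z; congr Witt; exact: gmulA. Qed.
Lemma wmulC : commutative wmul.
Proof. by move=> x y; congr Witt; exact: gmulC. Qed.
Lemma wmul1 : left_id wone wmul.
Proof. by move=> [x]; congr Witt; exact: gmul1. Qed.
Lemma wmulDl : left_distributive wmul wadd.
Proof. by move=> x y z; congr Witt; exact: gmulDl. Qed.
Lemma wone_neq0 : wone != wzero.
Proof. by apply/eqP => -[/(congr1 (@^~ 0%N))] /eqP; rewrite gzero.unlock gone.unlock oner_eq0. Qed.

HB.instance Definition _ := GRing.isZmodule.Build W waddA waddC wadd0 waddN.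
HB.instance Definition _ :=
  GRing.Zmodule_isComNzRing.Build W wmulA wmulC wmul1 wmulDl wone_neq0.
End WittRing.

(* From here on, T = Z^(2n) is the set of integer row vectors and matrices act
   on the right: the endomorphism with matrix A is x |-> x *m A, so that a
   composite "first A, then B" is A *m B.  T (x) S is 'rV[S]_(2n), and x (x) s
   is s *: map_mx intr x. *)

Section WittSetting.
Variables (p : nat) (p_pr : prime p) (kbar : closedFieldType).
Local Notation W := (witt p_pr kbar).

Definition wfrob (x : W) : W := Witt p_pr (fun i => wcoord x i ^+ p).

(* The inverse of wfrob, which is bijective when kbar has characteristic p. *)
Definition wfrob_inv (x : W) : W := xget 0 [set y | wfrob y = x]%classic.

(* W(E), as a subset of W(kbar), for a subfield E of kbar *)
Definition witt_over (E : {pred kbar}) (x : W) : Prop :=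
  forall i, wcoord x i \in E.

Definition prime_field : {pred kbar} := [pred x | x ^+ p == x].

(* Z_p = W(F_p) *)
Definition Zp_in_W : W -> Prop := witt_over prime_field.

Section Traces.
Variables E L : {pred kbar}.

Definition witt_basis (m : nat) (e : 'I_m -> W) : Prop :=
  (forall i, witt_over L (e i)) /\
  (forall x, witt_over L x ->
     exists! c : 'rV[W]_m, (forall i, witt_over E (c 0 i)) /\
                           x = \sum_i c 0 i * e i).

(* t is the trace of x for the extension W(E) of free rings in W(L): the trace
   of the matrix of multiplication by x in a W(E)-basis of W(L). *)
Definition witt_trace (x t : W) : Prop :=
  exists (m : nat) (e : 'I_m -> W) (A : 'M[W]_m),
    [/\ witt_basis e, forall i j, witt_over E (A i j),
        forall i, x * e i = \sum_j A i j * e j & t = \tr A].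
End Traces.
End WittSetting.

Section PadicTopology.
Variable p : nat.

Definition padic_close (U : zmodType) (N : nat) (x y : U) : Prop :=
  exists z, x - y = z *+ p ^ N.

Definition padic_continuous (U U' : zmodType) (f : U -> U') : Prop :=
  forall x N, exists M, forall y, padic_close M y x -> padic_close N (f y) (f x).
End PadicTopology.

(* algebraicOver, for a map whose source is only known to be a ring *)
Definition algebraic_over (A : nzRingType) (K : fieldType) (f : A -> K) (z : K) :
    Prop :=
  exists2 P : {poly A}, P != 0 & root (map_poly f P) z.

(* v is val_p: the extension to the algebraic closure of Frac(eps(W)) in C of
   the p-adic valuation of W, normalized by val_p(p) = 1.  It is unique on
   nonzero elements, W being complete; its values at 0 and at elements that
   are not algebraic over eps(W) are irrelevant. *)
Record is_valp (p : nat) (p_pr : prime p) (kbar : closedFieldType)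
    (R : realType) (eps : witt p_pr kbar -> R[i]) (v : R[i] -> rat) : Prop := {
  valp_W : forall (N : nat) (u u' : witt p_pr kbar),
    u * u' = 1 -> v (eps (u *+ p ^ N)) = N%:R;
  valpM : forall x y, x != 0 -> y != 0 ->
    algebraic_over eps x -> algebraic_over eps y -> v (x * y) = v x + v y;
  valpD : forall x y, x != 0 -> y != 0 -> x + y != 0 ->
    algebraic_over eps x -> algebraic_over eps y -> Num.min (v x) (v y) <= v (x + y)
}.

Definition semisimple_mx (K : fieldType) (m : nat) (A : 'M[K]_m) : Prop :=
  forall U : 'M[K]_m, stablemx U A ->
  exists U' : 'M[K]_m,
    [/\ stablemx U' A, row_full (U + U')%MS & (U :&: U')%MS = 0].

(* The eigenvalues of F in the algebraic closure of Q_p, with multiplicity, are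
   taken inside C, where val (is_valp) is defined on the algebraic closure of
   Q_p = Frac(eps(Z_p)). *)
Record deligne_module (R : realType) (val : R[i] -> rat) (p a n : nat)
    (F V : 'M[int]_(2 * n)) : Prop := {
  deligne_semisimple : semisimple_mx (map_mx intr F : 'M[rat]_(2 * n));
  deligne_weil : forall z : R[i],
    eigenvalue (map_mx intr F) z -> `|z| = sqrtC (p ^ a)%:R;
  deligne_ordinary : exists s : seq R[i],
    [/\ char_poly (map_mx intr F) = \prod_(z <- s) ('X - z%:P),
        count (fun z => val z == 0) s = n &
        count (fun z => a%:R <= val z) s = n];
  deligne_middle : coprimez (char_poly F)`_n p;
  deligne_FV : F *m V = (p ^ a)%:R%:M;
  deligne_VF : V *m F = (p ^ a)%:R%:M
}.

Definition bform (S : pzRingType) (m : nat) (B : 'M[S]_m) (x y : 'rV[S]_m) : S :=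
  (x *m B *m y^T) 0 0.

Section Polarization.
Variables (R : realType) (val : R[i] -> rat) (m : nat).

(* horner_mx is not available in dimension 0 *)
Definition poly_mx (g : {poly rat}) (A : 'M[rat]_m) : 'M[rat]_m :=
  \sum_(i < size g) g`_i *: A ^+ i.

Definition in_QF (A : 'M[rat]_m) : 'M[rat]_m -> Prop :=
  fun B => exists g, B = poly_mx g A.

Definition QF_embedding (A : 'M[rat]_m) (phi : 'M[rat]_m -> R[i]) : Prop :=
  [/\ phi 1 = 1,
      forall B C, in_QF A B -> in_QF A C -> phi (B + C) = phi B + phi C &
      forall B C, in_QF A B -> in_QF A C -> phi (B * C) = phi B * phi C].

Definition CM_type (A : 'M[rat]_m) (phi : 'M[rat]_m -> R[i]) : Prop :=
  QF_embedding A phi /\ 0 < val (phi A).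

(* The complex conjugation of Q[F] is g(F) |-> g(V). *)
Definition Phi_positive_imaginary (A A' B : 'M[rat]_m) : Prop :=
  (exists g, B = poly_mx g A /\ poly_mx g A' = - B) /\
  (forall phi, CM_type A phi -> exists y : R, 0 < y /\ phi B = (0 +i* y)%C).

Record polarization (F V omega : 'M[int]_m) : Prop := {
  pol_alternating : forall x, bform omega x x = 0;
  pol_nondegenerate : forall x : 'rV[rat]_m,
    (forall y, bform (map_mx intr omega) x y = 0) -> x = 0;
  pol_FV : forall x y, bform omega (x *m F) y = bform omega x (y *m V);
  pol_positive : forall B : 'M[rat]_m,
    Phi_positive_imaginary (map_mx intr F) (map_mx intr V) B ->
    (forall x y, bform (map_mx intr omega) x (y *m B) =
                 bform (map_mx intr omega) y (x *m B)) /\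
    (forall x, x != 0 -> 0 < bform (map_mx intr omega) x (x *m B))
}.

Record real_structure (F V omega tau : 'M[int]_m) : Prop := {
  real_invol : tau *m tau = 1%:M;
  real_FV : invmx tau *m F *m tau = V;
  real_omega : forall x y, bform omega (x *m tau) (y *m tau) = - bform omega x y
}.
End Polarization.

Section Dieudonne.
Variables (p : nat) (p_pr : prime p) (kbar : closedFieldType).
Local Notation W := (witt p_pr kbar).
Variables (a m : nat) (F : 'M[int]_m).
Local Notation TW := 'rV[W]_m.
Local Notation FW := (map_mx intr F : 'M[W]_m).

Definition T_Zp (x : TW) : Prop := forall i, Zp_in_W (x 0 i).

Definition Zp_submodule (S : TW -> Prop) : Prop :=
  [/\ forall x, S x -> T_Zp x, S 0, forall x y, S x -> S y -> S (x + y) &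
      forall c x, Zp_in_W c -> S x -> S (c *: x)].

(* T (x) Z_p = T1 (+) T2 *)
Record unit_splitting (T1 T2 : TW -> Prop) : Prop := {
  split_sub1 : Zp_submodule T1;
  split_sub2 : Zp_submodule T2;
  split_sum : forall x, T_Zp x -> exists x1 x2, [/\ T1 x1, T2 x2 & x = x1 + x2];
  split_direct : forall x, T1 x -> T2 x -> x = 0;
  split_stable1 : forall x, T1 x -> T1 (x *m FW);
  split_unit : forall y, T1 y -> exists! x, T1 x /\ x *m FW = y;
  split_stable2 : forall x, T2 x -> T2 (x *m FW);
  split_div : forall x, T2 x -> exists2 y, T2 y & x *m FW = y *+ p ^ a
}.

Variables T1 T2 : TW -> Prop.

(* The operators below are the additive maps of T (x) W with the prescribed
   values on the tensors t (x) w = w *: t with t in T1 or t in T2. *)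
Record is_galois_generator (pi : TW -> TW) : Prop := {
  pi_additive : {morph pi : x y / x + y};
  pi_T1 : forall t w, T1 t -> pi (w *: t) = iter a (@wfrob _ _ _) w *: (t *m FW);
  pi_T2 : forall t s w, T2 t -> T2 s -> t *m FW = s *+ p ^ a ->
    pi (w *: t) = iter a (@wfrob _ _ _) w *: s
}.

Record is_dieudonne_F (Fr : TW -> TW) : Prop := {
  dieuF_additive : {morph Fr : x y / x + y};
  dieuF_T1 : forall t w, T1 t -> Fr (w *: t) = wfrob w *: (t *+ p);
  dieuF_T2 : forall t w, T2 t -> Fr (w *: t) = wfrob w *: t
}.

Record is_dieudonne_V (Ve : TW -> TW) : Prop := {
  dieuV_additive : {morph Ve : x y / x + y};
  dieuV_T1 : forall t w, T1 t -> Ve (w *: t) = wfrob_inv w *: t;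
  dieuV_T2 : forall t w, T2 t -> Ve (w *: t) = wfrob_inv w *: (t *+ p)
}.
End Dieudonne.

Section RealDieudonne.
Variables (p : nat) (p_pr : prime p) (kbar : closedFieldType).
Local Notation W := (witt p_pr kbar).
Variable m : nat.

(* pi is a topological generator of the Galois group, so that its fixed points
   are the Galois invariants. *)
Definition dieudonne_module (pi : 'rV[W]_m -> 'rV[W]_m) (x : 'rV[W]_m) : Prop :=
  pi x = x.

Definition omega_p (omega : 'M[int]_m) : 'rV[W]_m -> 'rV[W]_m -> W :=
  bform (map_mx intr omega).

Variables (k : finFieldType) (iota : k -> kbar) (a : nat).

Definition W_of_k : W -> Prop := witt_over (mem (codom iota)).

Definition finite_extension (E : {pred kbar}) : Prop :=
  [/\ GRing.divring_closed E, {subset codom iota <= E} &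
      exists s : seq kbar, {subset E <= s}].

Record is_taubar (taubar : W -> W) : Prop := {
  taubar_continuous : padic_continuous p taubar;
  taubarD : {morph taubar : x y / x + y};
  taubarZ : forall c x, W_of_k c -> taubar (c * x) = c * taubar x;
  taubarK : involutive taubar;
  taubar_frob : forall x,
    taubar (iter a (@wfrob _ _ _) x) = iter a (@wfrob_inv _ _ _) (taubar x);
  taubar_over : forall E, finite_extension E ->
    forall x, witt_over E x -> witt_over E (taubar x);
  taubar_trace : forall E L, finite_extension E -> finite_extension L ->
    {subset E <= L} -> forall x t, witt_over L x ->
    witt_trace E L x t -> witt_trace E L (taubar x) (taubar t)
}.

Definition tau_p (tau : 'M[int]_m) (taubar : W -> W) (x : 'rV[W]_m) : 'rV[W]_m :=
  map_mx taubar x *m map_mx intr tau.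

Lemma tau_pD tau taubar : {morph taubar : x y / x + y} ->
  {morph tau_p tau taubar : x y / x + y}.
Proof.
move=> tbD x y; rewrite /tau_p -mulmxDl; congr (_ *m _).
by apply/matrixP => i j; rewrite !mxE tbD.
Qed.

Lemma tau_p_tensor tau taubar : {morph taubar : x y / x + y} ->
  forall (x : 'rV[int]_m) (w : W),
  tau_p tau taubar (w *: map_mx intr x) = taubar w *: map_mx intr (x *m tau).
Proof.
move=> tbD x w; rewrite map_mxM scalemxAl; congr (_ *m _).
have tb0 : taubar 0 = 0 by apply: (addrI (taubar 0)); rewrite -tbD !addr0.
have tbN y : taubar (- y) = - taubar y.
  by apply: (addrI (taubar y)); rewrite -tbD !subrr.
have tbMn y j : taubar (y *+ j) = taubar y *+ j.
  by elim: j => [|j IH]; rewrite ?mulr0n ?tb0 // !mulrS tbD IH.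
apply/matrixP => i j; rewrite !mxE !mulrzr.
by case: (x i j) => c; rewrite ?NegzE ?mulrNz -!pmulrn ?tbN tbMn.
Qed.
End RealDieudonne.

(* Main.v *)
From HB Require Import structures.
Require Import Defs.
From mathcomp Require Import all_boot all_order all_algebra finfield.
From mathcomp Require Import ring.
From mathcomp Require Import all_classical all_reals.
From mathcomp Require Import complex.
From mathcomp Require monalg.
Import -(notations) monalg.

Set Implicit Arguments.
Unset Strict Implicit.
Unset Printing Implicit Defensive.

Import Order.TTheory GRing.Theory Num.Theory.
Local Open Scope ring_scope.

(* Write W = W(kbar), phi = sigma^a, and let E1, E2 be the projections of T (x) W
   on T' (x) W and T'' (x) W.  Then pi x = phi(x) G, Fr^a x = phi(x) (p E1 + E2)^a
   and Ve^a x = phi^-1(x) (E1 + p E2)^a, where G is F on T' and F / q on T''.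
   Since tau and omega intertwine F and V, and F is invertible on T' and divisible
   by q on T'', separatedness of W gives E1 tau = tau E2, G tau G = tau and
   G omega G^T = omega; the first claims follow.

   taubar is not multiplicative, so the last claim is not formal.  It amounts to
   sum_l taubar(x_l) w_l = sum_l x_l taubar(w_l) for x in M(T) and
   w = omega taubar(y)^T, and one knows that phi^i(x) phi^j(w) only depends on
   i + j.  Let s_1, ..., s_d be elements of W, independent over W(k), whose
   W(k)-span contains all N x_l and N w_l for some nonzero N in W(k).  Then
   N^2 sum_l x_l (x) w_l is given by a matrix E over W(k), and, Om being the Casorati
   matrix (phi^i(s_j)), which is nonsingular, Om E Om^T is symmetric.  So E is
   symmetric, which is enough as taubar is W(k)-linear. *)

(** * Witt vectors in characteristic p *)

Local Notation vpoly := (malg (cmonom (nat * nat)%type) int).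

Section WittTheory.
Variables (p : nat) (p_pr : prime p).

Definition wmap (R S : comNzRingType) (f : {rmorphism R -> S})
  (x : witt p_pr R) : witt p_pr S := Witt p_pr (f \o wcoord x).

Section Wmap.
Variables (R S : comNzRingType) (f : {rmorphism R -> S}).

Lemma wcoord_wmap x n : wcoord (wmap f x) n = f (wcoord x n).
Proof. by []. Qed.

Lemma wmapD : {morph wmap f : x y / x + y}.
Proof. by move=> x y; congr Witt; rewrite /= -wop_map. Qed.

Lemma wmapM : {morph wmap f : x y / x * y}.
Proof. by move=> x y; congr Witt; rewrite /= -wop_map. Qed.

Lemma wmap1 : wmap f 1 = 1.
Proof. by congr Witt; rewrite /= map_gone. Qed.

Lemma wmap0 : wmap f 0 = 0.
Proof. by congr Witt; rewrite /= map_gzero. Qed.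

Lemma wmapMn x n : wmap f (x *+ n) = wmap f x *+ n.
Proof. by elim: n => [|n IH]; rewrite ?wmap0 // !mulrS wmapD IH. Qed.
End Wmap.

Lemma wghostD (R : comNzRingType) (x y : witt p_pr R) n :
  ghost p (wcoord (x + y)) n = ghost p (wcoord x) n + ghost p (wcoord y) n.
Proof. exact: ghost_wadd. Qed.

Lemma wghostM (R : comNzRingType) (x y : witt p_pr R) n :
  ghost p (wcoord (x * y)) n = ghost p (wcoord x) n * ghost p (wcoord y) n.
Proof. exact: ghost_wmul. Qed.

Lemma wghostMn (R : comNzRingType) (x : witt p_pr R) m n :
  ghost p (wcoord (x *+ m)) n = ghost p (wcoord x) n *+ m.
Proof.
elim: m => [|m IH]; first by rewrite !mulr0n; exact: ghost_gzero.
by rewrite !mulrS wghostD IH.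
Qed.

Lemma ghost0 (R : comNzRingType) (x : nat -> R) : ghost p x 0 = x 0%N.
Proof. by rewrite /ghost big_ord_recl big_ord0 addr0. Qed.

Lemma wcoord0D (R : comNzRingType) (x y : witt p_pr R) :
  wcoord (x + y) 0 = wcoord x 0 + wcoord y 0.
Proof. by rewrite -!(ghost0 (wcoord _)) wghostD. Qed.

Lemma wcoord0M (R : comNzRingType) (x y : witt p_pr R) :
  wcoord (x * y) 0 = wcoord x 0 * wcoord y 0.
Proof. by rewrite -!(ghost0 (wcoord _)) wghostM. Qed.

Lemma wcoord1 (R : comNzRingType) : wcoord (1 : witt p_pr R) 0 = 1.
Proof. by rewrite -(ghost0 (wcoord _)) ghost_gone. Qed.

Lemma wcoord_0 (R : comNzRingType) n : wcoord (0 : witt p_pr R) n = 0.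
Proof. by rewrite /= gzero.unlock. Qed.

(** * Ghost components over torsion-free rings *)

Section TorsionFree.
Variable R : comNzRingType.
Hypothesis torsfree : forall (a b : R) n, (0 < n)%N -> a *+ n = b *+ n -> a = b.

(** By strong induction, the lower coordinates agree modulo p, so their terms in the n-th ghost
    component agree modulo p^(n+1). What remains is p^n (x_n - y_n), and p^n cancels. *)
Lemma eq_ghost_mod (x y : nat -> R) :
  (forall n, mdvd (p ^ n.+1) (ghost p x n - ghost p y n)) ->
  forall n, mdvd p (x n - y n).
Proof.
move=> h n; have [N] := ubnP n; elim: N n => // N IH n; rewrite ltnS => leN.
have [z hz] := h n; have p0 := prime_gt0 p_pr.
have [w hw] : mdvd (p ^ n.+1) (ghost_low p x n - ghost_low p y n).
  rewrite -sumrB; apply: mdvd_sum => i.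
  rewrite -mulrnBl; have -> : (p ^ n.+1 = p ^ (n - i).+1 * p ^ i)%N.
    by rewrite -expnD addSn subnK // ltnW.
  apply: mdvdMn; apply: mdvd_exp_subX => //; apply: IH; exact: leq_trans leN.
exists (z - w); apply: (@torsfree _ _ (p ^ n)); first by rewrite expn_gt0 p0.
rewrite -mulrnA -expnS mulrnBl hz hw !ghostE mulrnBl.
have sub4 (a b c d : R) : a + b - (c + d) - (a - c) = b - d by ring.
exact: sub4.
Qed.

Lemma eq_ghost_below (x y : nat -> R) n :
  (forall i, (i < n)%N -> ghost p x i = ghost p y i) ->
  forall i, (i < n)%N -> x i = y i.
Proof.
move=> h i; have [N] := ubnP i; elim: N i => // N IH i; rewrite ltnS => leN lin.
have := h i lin; rewrite !ghostE (@eq_ghost_low _ _ x y) => [/addrI|j ltji].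
  by apply: torsfree; rewrite expn_gt0 prime_gt0.
by apply: IH; [exact: leq_trans leN|exact: ltn_trans lin].
Qed.
End TorsionFree.

Lemma ghost_below (R : comNzRingType) (x y : nat -> R) n i : (i < n)%N ->
  (forall j, (j < n)%N -> x j = y j) -> ghost p x i = ghost p y i.
Proof.
move=> lin h; apply: eq_bigr => j _; rewrite h //.
by apply: leq_ltn_trans lin; rewrite -ltnS.
Qed.

(** The two sums agree term by term, except for the top term p^(n+1) x_n. *)
Lemma ghost_shift (R : comNzRingType) (x : nat -> R) n :
  mdvd (p ^ n.+1)
    (ghost p x n *+ p - ghost p (fun n => if n is n'.+1 then x n' ^+ p else 0) n).
Proof.
case: n => [|n]; first by rewrite !ghost0 subr0 expn1; exists (x 0%N).
rewrite ghostE /ghost [X in _ - X]big_ord_recl /= expr0n expn_eq0.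
rewrite (gtn_eqF (prime_gt0 p_pr)) /= mul0rn add0r.
exists (x n.+1); rewrite mulrnDl -mulrnA -expnSr addrAC -sumrMnl -sumrB big1 ?add0r // => i _.
rewrite /bump /= add1n subSS -exprM -expnS -subSn ?expnSr ?mulrnA ?subrr //.
by rewrite -ltnS.
Qed.

Section Trunc.
Variables (R : comNzRingType).

(** Reduces statements on truncations to a polynomial ring, where ghost components determine
    coordinates. [Y] copies [X] below [n], which is compatible with [f] because [x] and [y] agree
    there. *)
Lemma gen_pair (x y z : witt p_pr R) n :
  (forall i, (i < n)%N -> wcoord x i = wcoord y i) ->
  exists (f : {rmorphism vpoly -> R}) (X Y Z : witt p_pr vpoly),
    [/\ x = wmap f X, y = wmap f Y, z = wmap f Z &
        forall i, (i < n)%N -> ghost p (wcoord X) i = ghost p (wcoord Y) i].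
Proof.
move=> h; have [f [hx hy hz]] := gen_vec (wcoord x) (wcoord y) (wcoord z).
exists f, (Witt p_pr (genv 0)),
  (Witt p_pr (fun i => if (i < n)%N then genv 0 i else genv 1 i)), (Witt p_pr (genv 2)).
split.
- by apply: wittP => i; rewrite hx.
- apply: wittP => i /=; case: ifP => [lin|_]; last by rewrite hy.
  by rewrite -h // hx.
- by apply: wittP => i; rewrite hz.
- by move=> i lin; apply: (@ghost_below _ _ _ n) => // j /= ->.
Qed.

Lemma wcoordD_below (x y z : witt p_pr R) n :
  (forall i, (i < n)%N -> wcoord x i = wcoord y i) ->
  forall i, (i < n)%N -> wcoord (x + z) i = wcoord (y + z) i.
Proof.
move=> /gen_pair - /(_ z) [f [X [Y [Z [-> -> -> h]]]]] i lin.
rewrite -!wmapD !wcoord_wmap; congr (f _).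
have e := @eq_ghost_below _ vpoly_torsfree (wcoord (X + Z)) (wcoord (Y + Z)) n.
by apply: e lin => j ltj; rewrite !wghostD h.
Qed.

Lemma wcoordM_below (x y z : witt p_pr R) n :
  (forall i, (i < n)%N -> wcoord x i = wcoord y i) ->
  forall i, (i < n)%N -> wcoord (x * z) i = wcoord (y * z) i.
Proof.
move=> /gen_pair - /(_ z) [f [X [Y [Z [-> -> -> h]]]]] i lin.
rewrite -!wmapM !wcoord_wmap; congr (f _).
have e := @eq_ghost_below _ vpoly_torsfree (wcoord (X * Z)) (wcoord (Y * Z)) n.
by apply: e lin => j ltj; rewrite !wghostM h.
Qed.
End Trunc.

(** * Multiplication by p in characteristic p *)

Section CharP.
Variables (R : comNzRingType) (chR : p \in [pchar R]).
Local Notation W := (witt p_pr R).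

(** The formula p = VF: by [ghost_shift] it holds modulo p for universal vectors, and p vanishes in
    [R]. *)
Lemma wcoord_mulp (x : W) n :
  wcoord (x *+ p) n = if n is n'.+1 then wcoord x n' ^+ p else 0.
Proof.
have [f [hx _ _]] := gen_vec (wcoord x) (wcoord x) (wcoord x).
pose X : witt p_pr vpoly := Witt p_pr (genv 0).
pose Y n := if n is n'.+1 then genv 0 n' ^+ p else 0.
have -> : x = wmap f X by apply: wittP => i; rewrite hx.
rewrite -wmapMn wcoord_wmap.
have -> : (if n is n'.+1 then f (genv 0 n') ^+ p else 0) = f (Y n).
  by case: n => [|n]; rewrite ?rmorph0 //= rmorphXn.
suff [z hz] : mdvd p (wcoord (X *+ p) n - Y n).
  apply/eqP; rewrite -subr_eq0 -rmorphB -hz rmorphMn /=.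
  by rewrite -mulr_natr (pcharf0 chR) mulr0.
by apply: (eq_ghost_mod vpoly_torsfree) => {}n; rewrite wghostMn; exact: ghost_shift.
Qed.

Lemma wcoord_mulpX (x : W) n i :
  wcoord (x *+ p ^ n) i = if (i < n)%N then 0 else wcoord x (i - n) ^+ (p ^ n).
Proof.
elim: n i => [|n IH] i; first by rewrite mulr1n subn0.
rewrite expnSr mulrnA wcoord_mulp; case: i => [//|i].
rewrite IH ltnS subSS; case: ifP => _; last by rewrite -exprM -expnSr.
by rewrite expr0n gtn_eqF // prime_gt0.
Qed.

Lemma witt_separated (x : W) : (forall n, exists z, x = z *+ p ^ n) -> x = 0.
Proof.
move=> h; apply: wittP => i; have [z ->] := h i.+1.
by rewrite wcoord_mulpX ltnSn wcoord_0.
Qed.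

Lemma wcoordD_mulpX (x y : W) n i :
  (i < n)%N -> wcoord (x + y *+ p ^ n) i = wcoord x i.
Proof.
move=> lin; rewrite addrC -[in RHS](add0r x).
apply: (@wcoordD_below _ _ _ _ n) => // j ltj.
by rewrite wcoord_mulpX ltj wcoord_0.
Qed.
End CharP.

(** * Units and divisibility by p over a perfect field *)

Section Perfect.
Variables (K : fieldType) (chK : p \in [pchar K]).
Local Notation W := (witt p_pr K).

Lemma witt_mulpX_eq0 (x : W) n : x *+ p ^ n = 0 -> x = 0.
Proof.
move=> h; apply: wittP => l; have := congr1 (fun w => wcoord w (l + n)) h.
rewrite (wcoord_mulpX chK) !wcoord_0 ltnNge leq_addl /= addnK => /eqP.
by rewrite expf_eq0 => /andP[_ /eqP].
Qed.

Hypothesis perfect : forall x : K, exists y, y ^+ p = x.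

Lemma wcoord0_eq0 (x : W) : wcoord x 0 = 0 -> exists z, x = z *+ p.
Proof.
move=> x0; have [r hr] := choice perfect.
exists (Witt p_pr (fun i => r (wcoord x i.+1))); apply: wittP => i.
by rewrite (wcoord_mulp chK); case: i => [//|i] /=; rewrite hr.
Qed.

(** Induction on the index of a nonzero coordinate: dividing by p lowers this index by one. *)
Lemma witt_mulpX_unit (x : W) :
  x != 0 -> exists n u, x = u *+ p ^ n /\ wcoord u 0 != 0.
Proof.
move=> x0; have [i hi] : exists i, wcoord x i != 0.
  apply: contrapT => /forallNP h; move/eqP: x0; apply; apply: wittP => i.
  by rewrite wcoord_0; apply/eqP; move: (h i) => /negP; rewrite negbK.
elim: i => [|i IH] in x x0 hi *; first by exists 0%N, x.
have [/wcoord0_eq0[z xz]|nz] := eqVneq (wcoord x 0) 0; last by exists 0%N, x.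
have zi : wcoord z i != 0.
  move: hi; rewrite xz (wcoord_mulp chK); apply: contraNN => /eqP ->.
  by rewrite expr0n gtn_eqF // prime_gt0.
have z0 : z != 0 by apply: contraNneq zi => ->; rewrite wcoord_0.
have [n [u [zu u0]]] := IH z z0 zi.
by exists n.+1, u; split=> //; rewrite xz zu -mulrnA expnSr.
Qed.

(* Geometric series: if y0 inverts x modulo p, then x y0 = 1 - p z and the
   inverse of x is y0 (1 + p z + (p z)^2 + ...), computed coordinatewise. *)
Lemma witt_unit (x : W) : wcoord x 0 != 0 -> exists y, x * y = 1.
Proof.
move=> x0; pose y0 : W := Witt p_pr (fun i => (wcoord x 0)^-1).
have [z hz] : exists z, 1 - x * y0 = z *+ p.
  apply: wcoord0_eq0; apply: (addIr (wcoord (x * y0) 0)).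
  by rewrite -wcoord0D subrK add0r wcoord0M wcoord1 mulfV.
pose s n := y0 * \sum_(i < n) (z *+ p) ^+ i.
have sS n : s n.+1 = s n + (y0 * z ^+ n) *+ p ^ n.
  by rewrite /s big_ord_recr mulrDr /= exprMn_n mulrnAr.
have s_stable n i m : (i < n)%N -> wcoord (s (n + m)%N) i = wcoord (s n) i.
  move=> lin; elim: m => [|m IH]; first by rewrite addn0.
  by rewrite addnS sS (wcoordD_mulpX chK) // (leq_trans lin) // leq_addr.
have xs n : x * s n = 1 - z ^+ n *+ p ^ n.
  have -> : x * s n = (1 - z *+ p) * \sum_(i < n) (z *+ p) ^+ i.
    by rewrite /s mulrA -hz; congr (_ * _); ring.
  by rewrite -[RHS]opprB -exprMn_n subrX1 -mulNr opprB.
(* Coordinate i of the partial sums is stable from [s i.+1] on. *)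
pose y : W := Witt p_pr (fun i => wcoord (s i.+1) i).
exists y; apply: wittP => i.
have -> : wcoord (x * y) i = wcoord (x * s i.+1) i.
  rewrite ![x * _]mulrC; apply: (@wcoordM_below _ _ _ _ i.+1) => // j /=.
  rewrite ltnS => leji; have := @s_stable j.+1 j (i - j)%N (ltnSn j).
  by rewrite addSn subnKC.
by rewrite xs -mulNrn (wcoordD_mulpX chK).
Qed.
End Perfect.
End WittTheory.

(** * The Frobenius of W(kbar) and its fixed points *)

Section WittFrobenius.
Variables (p : nat) (p_pr : prime p) (kbar : closedFieldType).
Hypothesis chK : p \in [pchar kbar].
Local Notation W := (witt p_pr kbar).

Lemma closed_perfect (x : kbar) : exists y, y ^+ p = x.
Proof.
have [y hy] := @solve_monicpoly kbar p (fun i => if i == 0%N then x else 0) (prime_gt0 p_pr).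
exists y; rewrite hy; case: p (prime_gt0 p_pr) => // n _.
rewrite big_ord_recl /= expr0 mulr1 big1 ?addr0 // => i _.
by rewrite mul0r.
Qed.

Lemma wfrobE (x : W) : wfrob x = wmap (pFrobenius_aut chK) x.
Proof. by apply: wittP => i. Qed.

Lemma wfrobD : {morph (@wfrob p p_pr kbar) : x y / x + y}.
Proof. by move=> x y; rewrite !wfrobE wmapD. Qed.

Lemma wfrobM : {morph (@wfrob p p_pr kbar) : x y / x * y}.
Proof. by move=> x y; rewrite !wfrobE wmapM. Qed.

Lemma wfrob1 : wfrob (1 : W) = 1.
Proof. by rewrite wfrobE wmap1. Qed.

Lemma wfrob_inj : injective (@wfrob p p_pr kbar).
Proof.
move=> x y /(congr1 (@wcoord _ _ _)) h; apply: wittP => i.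
exact: (fmorph_inj (pFrobenius_aut chK) (congr1 (@^~ i) h)).
Qed.

Lemma wfrob_invK (x : W) : wfrob (wfrob_inv x) = x.
Proof.
have [r hr] := choice closed_perfect.
apply: (@xgetPex _ 0 [set y | wfrob y = x]%classic).
by exists (Witt p_pr (r \o wcoord x)); apply: wittP => i /=.
Qed.

Lemma wfrob_iter_morph a :
  exists phi : {rmorphism W -> W}, forall x, phi x = iter a (@wfrob p p_pr kbar) x.
Proof.
have hB : zmod_morphism (iter a (@wfrob p p_pr kbar)).
  elim: a => // a IH x y; rewrite /= IH.
  apply: (addIr (wfrob (iter a (@wfrob p p_pr kbar) y))).
  by rewrite -wfrobD !subrK.
have hM : monoid_morphism (iter a (@wfrob p p_pr kbar)).
  split; first by elim: a {hB} => // a /= ->; exact: wfrob1.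
  by elim: a {hB} => // a IH x y; rewrite /= IH wfrobM.
pose f := iter a (@wfrob p p_pr kbar).
pose m1 := GRing.isZmodMorphism.Build W W f hB.
pose m2 := GRing.isMonoidMorphism.Build W W f hM.
pose phi : {rmorphism W -> W} := HB.pack f m1 m2.
by exists phi.
Qed.

Lemma iter_wfrob_invK a (x : W) :
  iter a (@wfrob p p_pr kbar) (iter a (@wfrob_inv p p_pr kbar) x) = x.
Proof. by elim: a x => // a IH x; rewrite iterSr /= wfrob_invK. Qed.

Lemma wcoord_iter_wfrob a (x : W) i :
  wcoord (iter a (@wfrob p p_pr kbar) x) i = wcoord x i ^+ (p ^ a).
Proof. by elim: a => // a IH; rewrite /= IH -exprM -expnSr. Qed.

Lemma wfrob_iter_inj a : injective (iter a (@wfrob p p_pr kbar)).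
Proof. by elim: a => // a IH x y /= /wfrob_inj/IH. Qed.

Lemma Zp_in_WE (x : W) : Zp_in_W x <-> wfrob x = x.
Proof.
split=> [h|h i]; first by apply: wittP => i; exact/eqP/(h i).
by rewrite inE -{2}h.
Qed.

Lemma Zp_iter_wfrob a (x : W) : Zp_in_W x -> iter a (@wfrob p p_pr kbar) x = x.
Proof. by move/Zp_in_WE => h; elim: a => // a /= ->. Qed.

(* Up to a power of p, a nonzero element of Frac(W) is a unit of W. *)
Lemma witt_fix_frac (phi : {rmorphism W -> W}) :
  forall a b : W, b != 0 -> b * phi a = a * phi b ->
  exists N M, [/\ phi N = N, phi M = M, N != 0 & N * a = M * b].
Proof.
move=> a b b0 hab.
have fixp n : phi (1 *+ p ^ n) = 1 *+ p ^ n by rewrite rmorphMn rmorph1.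
have [->|a0] := eqVneq a 0.
  by exists 1, 0; rewrite rmorph1 rmorph0 mulr0 mul0r oner_neq0.
have [i [u [au u0]]] := witt_mulpX_unit chK closed_perfect a0.
have [j [v [bv v0]]] := witt_mulpX_unit chK closed_perfect b0.
have [v' vv'] := witt_unit chK closed_perfect v0.
have uv : v * phi u = u * phi v.
  move: hab; rewrite au bv !rmorphMn !(mulrnAl, mulrnAr) -!mulrnA mulnC.
  move/eqP; rewrite -subr_eq0 -mulrnBl -expnD => /eqP h.
  by apply/eqP; rewrite -subr_eq0 (witt_mulpX_eq0 chK h).
(* As [v'] is the inverse of [v], [uv] says that the unit u / v is fixed. *)
have fixM : phi (u * v') = u * v'.
  have pv : phi v * phi v' = 1 by rewrite -rmorphM vv' rmorph1.
  rewrite rmorphM -[LHS]mul1r -vv'.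
  transitivity (v' * phi v' * (v * phi u)); first by ring.
  by rewrite uv; transitivity (u * v' * (phi v * phi v')); [ring|rewrite pv mulr1].
have pX0 n : (1 : W) *+ p ^ n != 0.
  apply/eqP => /(congr1 (fun w => wcoord w n)).
  rewrite (wcoord_mulpX chK) ltnn subnn wcoord1 expr1n wcoord_0 => /eqP.
  by rewrite oner_eq0.
exists (1 *+ p ^ j), (u * v' * (1 *+ p ^ i)); split=> //.
  by rewrite rmorphM fixM fixp.
rewrite au bv !(mulrnAl, mulrnAr) !mul1r !mulr1.
rewrite -mulrA (mulrC v') vv' mulr1; exact: mulrnAC.
Qed.
End WittFrobenius.

(** With q the order of [k], X^q - X is the product of the X - y over y in [k], so each of its roots
    in [L] is the image of some y. *)
Lemma finField_fixed (k : finFieldType) (L : fieldType) (f : {rmorphism k -> L}) (x : L) :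
  (x \in codom f) = (x ^+ #|k| == x).
Proof.
apply/codomP/eqP => [[y ->]|hx]; first by rewrite -rmorphXn expf_card.
have : root (map_poly f (\prod_(y : k) ('X - y%:P))) x.
  by rewrite -finField_genPoly rmorphB /= map_polyXn map_polyX rootE !hornerE hx subrr.
rewrite rmorph_prod /root horner_prod => /prodf_eq0[y _].
by rewrite rmorphB /= map_polyX map_polyC hornerXsubC subr_eq0 => /eqP ->; exists y.
Qed.

Lemma W_of_kE p (p_pr : prime p) (k : finFieldType) (kbar : closedFieldType)
  (iota : {rmorphism k -> kbar}) a (c : witt p_pr kbar) : #|k| = (p ^ a)%N ->
  W_of_k iota c <-> iter a (@wfrob p p_pr kbar) c = c.
Proof.
move=> card_k; split=> [h|h i].
  apply: wittP => i; rewrite wcoord_iter_wfrob -card_k; apply/eqP.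
  by rewrite -(finField_fixed iota); exact: h.
rewrite -[_ \in _]/(wcoord c i \in codom iota).
by rewrite finField_fixed card_k -wcoord_iter_wfrob h.
Qed.

(** * Casorati matrices *)

Section Casorati.
Variables (D : comNzRingType) (phi : {rmorphism D -> D}).
Hypothesis domD : GRing.integral_domain_axiom D.
Hypothesis phi_inj : injective phi.
(* Every element fixed by phi in the fraction field of D is a fraction of
   elements fixed by phi in D. *)
Hypothesis fix_frac : forall a b, b != 0 -> b * phi a = a * phi b ->
  exists N M, [/\ phi N = N, phi M = M, N != 0 & N * a = M * b].

Lemma dom_mul_neq0 (x y : D) : x != 0 -> y != 0 -> x * y != 0.
Proof. by move=> x0 y0; apply/eqP => /domD; rewrite (negPf x0) (negPf y0). Qed.

Lemma dom_mulI (c x y : D) : c != 0 -> c * x = c * y -> x = y.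
Proof.
move=> c0 /eqP; rewrite -subr_eq0 -mulrBr => /eqP/domD.
by rewrite (negPf c0) /= subr_eq0 => /eqP.
Qed.

(** The adjugate stands in for an inverse over the fraction field; the scalar det A then cancels in
    the domain. *)
Lemma det_mulmxI m n (A : 'M[D]_m) (B C : 'M_(m, n)) :
  \det A != 0 -> A *m B = A *m C -> B = C.
Proof.
move=> dA /(congr1 (mulmx (\adj A))); rewrite !mulmxA mul_adj_mx !mul_scalar_mx.
move=> /matrixP h; apply/matrixP => i j; have := h i j; rewrite !mxE.
exact: dom_mulI.
Qed.

Lemma det_mulIT m n (A : 'M[D]_m) (B C : 'M_(n, m)) :
  \det A != 0 -> B *m A^T = C *m A^T -> B = C.
Proof.
move=> dA /(congr1 trmx); rewrite !trmx_mul !trmxK => /(det_mulmxI dA).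
exact: trmx_inj.
Qed.

Lemma iter_morph i : {morph iter i phi : x y / x + y}.
Proof. by elim: i => // i IH x y; rewrite /= IH rmorphD. Qed.

Lemma iter_morphM i : {morph iter i phi : x y / x * y}.
Proof. by elim: i => // i IH x y; rewrite /= IH rmorphM. Qed.

Lemma iter_morph0 i : iter i phi 0 = 0.
Proof. by elim: i => // i /= ->; rewrite rmorph0. Qed.

Lemma iter_fix i c : phi c = c -> iter i phi c = c.
Proof. by move=> h; elim: i => // i /= ->. Qed.

Lemma iter_sumM i m (c s : 'I_m -> D) : (forall j, phi (c j) = c j) ->
  iter i phi (\sum_j s j * c j) = \sum_j iter i phi (s j) * c j.
Proof.
move=> hc; rewrite (big_morph _ (iter_morph i) (iter_morph0 i)).
by apply: eq_bigr => j _; rewrite iter_morphM (iter_fix _ (hc j)).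
Qed.

Definition casorati d (s : nat -> D) : 'M[D]_d :=
  \matrix_(i < d, j < d) iter i phi (s j).

(** An analogue of the Wronskian criterion. The cofactor relation has coefficients with phi-fixed
    ratios: otherwise it and its image under phi would give a nontrivial relation between the
    columns of a nonsingular matrix. *)
Lemma casorati_kernel d (s : nat -> D) :
  \det (casorati d s) != 0 -> \det (casorati d.+1 s) = 0 ->
  exists N (M : 'I_d -> D), [/\ phi N = N, N != 0, forall j, phi (M j) = M j &
    N * s d = \sum_j M j * s j].
Proof.
move=> d0 d1; set Om := casorati d.+1 s.
(* The cofactors along the last row give a relation between the columns; the last of them is the
   smaller, nonzero determinant. *)
pose c j := (\adj Om) j ord_max; pose cd := c ord_max.
have cdE : cd = \det (casorati d s).
  rewrite /cd /c mxE /cofactor -signr_odd addnn odd_double mul1r.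
  congr (\det _); apply/matrixP => i j; by rewrite !mxE !lift_max.
have rel i : \sum_(j < d.+1) iter (i : 'I_d.+1) phi (s j) * c j = 0.
  have : (Om *m \adj Om) i ord_max = 0.
    by rewrite mul_mx_adj d1 mxE mul0rn.
  by rewrite mxE => h; rewrite -[RHS]h; apply: eq_bigr => j _; rewrite mxE.
have cd0 : cd != 0 by rewrite cdE.
have fixc j : cd * phi (c (widen_ord (leqnSn d) j)) = c (widen_ord (leqnSn d) j) * phi cd.
  (* Cross-multiplying the relation with its image under phi kills the coefficient of the last
     column. *)
  pose e j := cd * phi (c j) - c j * phi cd.
  have rel' (i : 'I_d) : \sum_(j < d.+1) iter i.+1 phi (s j) * e j = 0.
    have r1 : \sum_(j < d.+1) iter i.+1 phi (s j) * phi (c j) = 0.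
      transitivity (phi (\sum_(j < d.+1) iter i phi (s j) * c j)).
        by rewrite rmorph_sum; apply: eq_bigr => l _; rewrite rmorphM.
      by rewrite (rel (widen_ord (leqnSn d) i)) rmorph0.
    have r2 : \sum_(j < d.+1) iter i.+1 phi (s j) * c j = 0 := rel (lift ord0 i).
    transitivity (cd * \sum_(j < d.+1) iter i.+1 phi (s j) * phi (c j) -
                  phi cd * \sum_(j < d.+1) iter i.+1 phi (s j) * c j).
      by rewrite !mulr_sumr -sumrB; apply: eq_bigr => l _; rewrite /e; ring.
    by rewrite r1 r2 !mulr0 subrr.
  have e0 : e ord_max = 0 by rewrite /e mulrC subrr.
  pose ev : 'cV[D]_d := \col_j e (widen_ord (leqnSn d) j).
  suff /matrixP/(_ j ord0) : ev = 0.
    by rewrite !mxE => /eqP; rewrite subr_eq0 => /eqP.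
  apply: (@det_mulmxI _ _ (map_mx phi (casorati d s))).
    by rewrite det_map_mx -(rmorph0 phi) (inj_eq phi_inj).
  rewrite mulmx0; apply/matrixP => i k; rewrite !mxE -[RHS](rel' i).
  rewrite big_ord_recr /= e0 mulr0 addr0; apply: eq_bigr => l _.
  by rewrite !mxE.
have /fin_all_exists[N /fin_all_exists[M NM]] :=
  fun j => fix_frac cd0 (fixc j).
(* [NN] is a common denominator of the ratios; the sign in [M'] below comes from isolating the term
   in [s d]. *)
pose NN := \prod_j N j.
have NNfix : phi NN = NN by rewrite rmorph_prod; apply: eq_bigr => j _; case: (NM j).
have NN0 : NN != 0.
  rewrite /NN; elim/big_ind : _ => //; [exact: oner_neq0|exact: dom_mul_neq0|].
  by move=> j _; case: (NM j).
pose M' j := - (\prod_(l | l != j) N l * M j).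
exists NN, M'; split=> //.
  move=> j; rewrite rmorphN rmorphM rmorph_prod; congr (- (_ * _)); last by case: (NM j).
  by apply: eq_bigr => l _; case: (NM l).
apply: (dom_mulI cd0).
have := rel ord0; rewrite /= big_ord_recr /= -/cd => /(congr1 ( *%R NN)).
rewrite mulr0 mulrDr addrC => /eqP; rewrite addr_eq0 => /eqP h.
rewrite mulrCA [cd * _]mulrC h mulr_sumr -sumrN mulr_sumr; apply: eq_bigr => j _.
have [_ _ _ NMj] := NM j.
rewrite /M' /NN (bigD1 j) //= mulNr mulrN; congr (- _).
set P := \prod_(l | _) _.
transitivity (P * s j * (N j * c (widen_ord (leqnSn d) j))); first by ring.
rewrite NMj; ring.
Qed.

(** Elements are adjoined to [s] as long as the Casorati determinant stays nonzero. Otherwise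
    [casorati_kernel] puts a multiple of the new element in the span, and the factor is absorbed
    into [N]. *)
Lemma casorati_span (l : seq D) : exists d (s : nat -> D) N,
  [/\ \det (casorati d s) != 0, phi N = N, N != 0 &
    forall v, v \in l -> exists c : 'I_d -> D,
      (forall j, phi (c j) = c j) /\ N * v = \sum_(j < d) s j * c j].
Proof.
elim: l => [|b l [d [s [N [d0 Nfix N0 hN]]]]].
  exists 0%N, (fun=> 0), 1; split=> //; rewrite ?rmorph1 ?oner_neq0 //.
  by rewrite det_mx00 oner_neq0.
pose s' j := if (j < d)%N then s j else b.
have s'E (j : 'I_d) : s' j = s j by rewrite /s' ltn_ord.
have s'd : s' d = b by rewrite /s' ltnn.
have casE : casorati d s' = casorati d s.
  by apply/matrixP => i j; rewrite !mxE s'E.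
have [d1|d1] := eqVneq (\det (casorati d.+1 s')) 0.
  have := casorati_kernel (s := s') (d := d); rewrite casE s'd => /(_ d0 d1).
  move=> [N' [M [N'fix N'0 Mfix hM]]].
  exists d, s, (N * N'); split=> //; first by rewrite rmorphM Nfix N'fix.
    exact: dom_mul_neq0.
  move=> v; rewrite inE => /predU1P[->|vl].
    exists (fun j => N * M j); split=> [j|]; first by rewrite rmorphM Nfix Mfix.
    by rewrite -mulrA hM mulr_sumr; apply: eq_bigr => j _; rewrite s'E; ring.
  have [c [cfix hc]] := hN v vl; exists (fun j => N' * c j); split=> [j|].
    by rewrite rmorphM N'fix cfix.
  by rewrite mulrAC hc mulr_suml; apply: eq_bigr => j _; ring.
exists d.+1, s', N; split=> // v; rewrite inE => /predU1P[->|vl].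
  exists (fun j : 'I_d.+1 => if j == ord_max then N else 0); split=> [j|].
    by case: ifP; rewrite ?rmorph0.
  rewrite big_ord_recr /= eqxx s'd big1 ?add0r 1?mulrC // => j _.
  case: eqP => [/(congr1 val) /= jd|_]; last by rewrite mulr0.
  by have := ltn_ord j; rewrite jd ltnn.
have [c [cfix hc]] := hN v vl.
(* The old coefficients are extended by 0 at the new last index. *)
exists (fun j : 'I_d.+1 => if insub (val j) is Some k then c k else 0); split=> [j|].
  by case: insub => [k|]; rewrite ?rmorph0.
rewrite hc big_ord_recr /= insubF ?ltnn // mulr0 addr0; apply: eq_bigr => j _.
by rewrite s'E valK.
Qed.

(* Expressed in elements s with nonsingular Casorati matrix Om, the tensor
   sum_l x_l (x) w_l has a matrix E over the fixed ring, and the hypothesis says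
   that Om E Om^T is symmetric; hence so is E. *)
Lemma semilinear_swap (T : D -> D) m (x w : 'I_m -> D) :
  {morph T : u v / u + v} -> (forall c u, phi c = c -> T (c * u) = c * T u) ->
  (forall i j, \sum_l iter i phi (x l) * iter j phi (w l) =
               \sum_l iter j phi (x l) * iter i phi (w l)) ->
  \sum_l T (x l) * w l = \sum_l x l * T (w l).
Proof.
move=> TD TZ sym.
have T0 : T 0 = 0 by apply: (addrI (T 0)); rewrite -TD !addr0.
have [d [s [N [Om0 Nfix N0 hN]]]] :=
  casorati_span ([seq x l | l <- enum 'I_m] ++ [seq w l | l <- enum 'I_m]).
have /fin_all_exists[P hP] : forall l, exists c : 'I_d -> D,
    (forall j, phi (c j) = c j) /\ N * x l = \sum_(j < d) s j * c j.
  by move=> l; apply: hN; rewrite mem_cat map_f ?mem_enum.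
have /fin_all_exists[Q hQ] : forall l, exists c : 'I_d -> D,
    (forall j, phi (c j) = c j) /\ N * w l = \sum_(j < d) s j * c j.
  by move=> l; apply: hN; rewrite mem_cat orbC map_f ?mem_enum.
pose Om := casorati d s; pose E : 'M[D]_d := \matrix_(a, b) \sum_l P l a * Q l b.
have iterN i u : iter i phi (N * u) = N * iter i phi u.
  by rewrite iter_morphM (iter_fix _ Nfix).
have double (f g : 'I_d -> D) : \sum_a \sum_b f a * E a b * g b =
    \sum_l (\sum_a f a * P l a) * (\sum_b g b * Q l b).
  transitivity (\sum_a \sum_b \sum_l f a * P l a * (g b * Q l b)).
    apply: eq_bigr => a _; apply: eq_bigr => b _; rewrite mxE mulr_sumr mulr_suml.
    by apply: eq_bigr => l _; ring.
  transitivity (\sum_a \sum_l \sum_b f a * P l a * (g b * Q l b)).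
    by apply: eq_bigr => a _; rewrite exchange_big.
  rewrite exchange_big; apply: eq_bigr => l _; rewrite mulr_suml.
  by apply: eq_bigr => a _; rewrite mulr_sumr.
have OmE i j : (Om *m E *m Om^T) i j =
    N * N * \sum_l iter i phi (x l) * iter j phi (w l).
  transitivity (\sum_(a < d) \sum_(b < d) iter i phi (s a) * E a b * iter j phi (s b)).
    rewrite mxE exchange_big; apply: eq_bigr => b _; rewrite !mxE mulr_suml.
    by apply: eq_bigr => a _; rewrite !mxE.
  rewrite double mulr_sumr; apply: eq_bigr => l _.
  have [Pfix Px] := hP l; have [Qfix Qw] := hQ l.
  rewrite -(iter_sumM _ _ Pfix) -(iter_sumM _ _ Qfix) -Px -Qw !iterN; ring.
have Esym : E^T = E.
  apply: (det_mulIT Om0); apply: (det_mulmxI Om0).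
  rewrite !mulmxA; apply/matrixP => i j.
  have -> : Om *m E^T *m Om^T = (Om *m E *m Om^T)^T by rewrite !trmx_mul trmxK mulmxA.
  by rewrite mxE !OmE sym.
have TN u : T (N * u) = N * T u by exact: TZ.
have Tsum (c : 'I_d -> D) : (forall j, phi (c j) = c j) ->
    T (\sum_(j < d) s j * c j) = \sum_(j < d) T (s j) * c j.
  move=> cfix; rewrite (big_morph _ TD T0); apply: eq_bigr => j _.
  by rewrite mulrC TZ // mulrC.
(* After multiplication by N^2 both sides are double sums in [s] and its image under [T], exchanged
   by the symmetry of [E]. *)
apply: (dom_mulI (dom_mul_neq0 N0 N0)); rewrite !mulr_sumr.
transitivity (\sum_(a < d) \sum_(b < d) T (s a) * E a b * s b).
  rewrite double; apply: eq_bigr => l _.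
  have [Pfix Px] := hP l; have [_ Qw] := hQ l.
  by rewrite -Tsum // -Px -Qw TN; ring.
transitivity (\sum_(a < d) \sum_(b < d) s a * E a b * T (s b)).
  rewrite exchange_big; apply: eq_bigr => a _; apply: eq_bigr => b _.
  by rewrite -{1}Esym mxE; ring.
rewrite double; apply: eq_bigr => l _.
have [_ Px] := hP l; have [Qfix Qw] := hQ l.
by rewrite -Tsum // -Px -Qw TN; ring.
Qed.
End Casorati.

(** * Splitting off the unit part of F *)

Section FittingSplitting.
Variables (D : comNzRingType) (q m : nat).
Hypothesis torsfree : forall x : D, x *+ q = 0 -> x = 0.
Hypothesis separated : forall x : D, (forall n, exists z, x = z *+ q ^ n) -> x = 0.
Implicit Types A B F V E Y S K Z : 'M[D]_m.

(* E1 and E2 are the projections on the part where F is invertible, with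
   inverse Y, and on the part where F is divisible by q, with F = q S. *)
Record fitting_splitting F V E1 E2 Y S : Prop := {
  fit_FV : F *m V = q%:R%:M;
  fit_VF : V *m F = q%:R%:M;
  fit_add : E1 + E2 = 1%:M;
  fit_E1F : E1 *m F = F *m E1;
  fit_YF : Y *m F = E1;
  fit_FY : F *m Y = E1;
  fit_YE1 : Y *m E1 = Y;
  fit_E1Y : E1 *m Y = Y;
  fit_SV : S *m V = E2;
  fit_VS : V *m S = E2;
  fit_SE2 : S *m E2 = S;
  fit_E2S : E2 *m S = S
}.

(** Serves for [omega], which intertwines F with the transpose of V. *)
Lemma fitting_tr F V E1 E2 Y S : fitting_splitting F V E1 E2 Y S ->
  fitting_splitting F^T V^T E1^T E2^T Y^T S^T.
Proof.
case=> *; split; rewrite -?trmx_mul; try by congr trmx.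
- by rewrite -[RHS]tr_scalar_mx; congr trmx.
- by rewrite -[RHS]tr_scalar_mx; congr trmx.
- by rewrite -linearD -[RHS]trmx1; congr trmx.
Qed.

Lemma mx_torsfree A B : A *+ q = B *+ q -> A = B :> 'M[D]_m.
Proof.
move=> /matrixP h; apply/matrixP => i j; have := h i j; rewrite !mulmxnE => /eqP.
by rewrite -subr_eq0 -mulrnBl => /eqP/torsfree/eqP; rewrite subr_eq0 => /eqP.
Qed.

Lemma mulmx_q A : A *m q%:R%:M = A *+ q :> 'M[D]_m.
Proof. by rewrite mul_mx_scalar scaler_nat. Qed.

Lemma mul_q_mx A : q%:R%:M *m A = A *+ q :> 'M[D]_m.
Proof. by rewrite mul_scalar_mx scaler_nat. Qed.

Lemma mulmxq A B : A *m (B *+ q) = (A *m B) *+ q.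
Proof. by rewrite -!mulmx_q mulmxA. Qed.

Lemma mulqmx A B : (A *+ q) *m B = (A *m B) *+ q.
Proof. by rewrite -!mul_q_mx mulmxA. Qed.

(** The remaining identities are checked after multiplication by q, where q becomes F V or V F and q
    S becomes E2 F; then q cancels. *)
Lemma fitting_intro F V E1 E2 Y S :
  F *m V = q%:R%:M -> V *m F = q%:R%:M -> E1 + E2 = 1%:M -> E1 *m F = F *m E1 ->
  Y *m F = E1 -> Y *m E1 = Y -> E2 *m F = S *+ q ->
  fitting_splitting F V E1 E2 Y S.
Proof.
move=> FV VF E12 E1F YF YE1 E2F.
have E1E1 : E1 *m E1 = E1 by rewrite -{1}YF -mulmxA -E1F mulmxA YE1.
have E2E : E2 = 1%:M - E1 by rewrite -E12 addrC addKr.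
have E2E2 : E2 *m E2 = E2.
  by rewrite {1}E2E mulmxBl mul1mx E2E mulmxBr mulmx1 E1E1 subrr subr0.
have E2F' : F *m E2 = S *+ q.
  by rewrite -E2F E2E mulmxBr mulmxBl mulmx1 mul1mx E1F.
have VE1 : V *m E1 = E1 *m V.
  apply: mx_torsfree.
  by rewrite -mulmx_q -FV mulmxA -(mulmxA V) E1F mulmxA VF mul_q_mx mulqmx.
have VE2 : V *m E2 = E2 *m V by rewrite E2E mulmxBr mulmxBl mulmx1 mul1mx VE1.
split=> //; apply: mx_torsfree.
- by rewrite -mulmx_q -FV mulmxA -(mulmxA F) YF -E1F -mulmxA FV mulmx_q.
- by rewrite -!mulmx_q -FV mulmxA -(mulmxA E1) YF E1E1 mulmxA YF.
- by rewrite -mulqmx -E2F -mulmxA FV mulmx_q.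
- by rewrite -mulmxq -E2F mulmxA VE2 -mulmxA VF mulmx_q.
- by rewrite -mulqmx -{1}E2F -mulmxA E2F' mulmxq -E2F -mulmxq -E2F mulmxA E2E2.
- by rewrite -mulmxq -E2F mulmxA E2E2.
Qed.

(** Substituting the equation into itself n times makes every entry of [Z] divisible by q^n. *)
Lemma contraction0 A B Z : Z = (A *m Z *m B) *+ q -> Z = 0.
Proof.
move=> hZ; apply/matrixP => i j; rewrite [RHS]mxE; apply: separated => n.
suff [A' [B' ->]] : exists A' B', Z = (A' *m Z *m B') *+ q ^ n.
  by eexists; rewrite mulmxnE.
elim: n => [|n [A' [B' {1}->]]].
  by exists 1%:M, 1%:M; rewrite mulmx1 mul1mx mulr1n.
exists (A' *m A), (B *m B'); rewrite expnS mulrnA; congr (_ *+ _).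
by rewrite {1}hZ mulmxq mulqmx !mulmxA.
Qed.

(** * Maps exchanging F and V; [K] will be [tau] or [omega] *)

Section Intertwine.
Variables (F V E1 E2 Y S F' V' E1' E2' Y' S' K : 'M[D]_m).
Hypothesis fit : fitting_splitting F V E1 E2 Y S.
Hypothesis fit' : fitting_splitting F' V' E1' E2' Y' S'.
Hypothesis FK : F *m K = K *m V'.
Hypothesis VK : V *m K = K *m F'.

(* On the image of E1, K conjugates the invertible F into V' = q F'^-1. *)
Lemma intertwine11 : E1 *m K *m E1' = 0.
Proof.
apply: (@contraction0 Y Y').
rewrite !mulmxA (fit_YE1 fit) -!mulmxA (fit_E1Y fit').
rewrite -{1}(fit_YF fit) -{1}(fit_FY fit') -mulmxA -mulmxq; congr (_ *m _).
by rewrite mulmxA FK -!mulmxA -mulmxq; congr (_ *m _); rewrite mulmxA (fit_VF fit') mul_q_mx.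
Qed.

(** Here E2 K E2' = S V K V' S' = q S K S', to which [contraction0] applies. *)
Lemma intertwine22 : E2 *m K *m E2' = 0.
Proof.
apply: (@contraction0 S S').
rewrite !mulmxA (fit_SE2 fit) -!mulmxA (fit_E2S fit').
rewrite -{1}(fit_SV fit) -{1}(fit_VS fit') -mulmxA -mulmxq; congr (_ *m _).
by rewrite mulmxA VK -!mulmxA -mulmxq; congr (_ *m _); rewrite mulmxA (fit_FV fit') mul_q_mx.
Qed.

Lemma intertwine12 : E1 *m K = K *m E2'.
Proof.
rewrite -[LHS]mulmx1 -(fit_add fit') mulmxDr intertwine11 add0r.
by rewrite -[K in RHS]mul1mx -(fit_add fit) !mulmxDl intertwine22 addr0.
Qed.

Lemma intertwine21 : E2 *m K = K *m E1'.
Proof.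
rewrite -[LHS]mulmx1 -(fit_add fit') mulmxDr intertwine22 addr0.
by rewrite -[K in RHS]mul1mx -(fit_add fit) !mulmxDl intertwine11 add0r.
Qed.

(** Only the two mixed blocks survive: in one, F K S' = K V' S' = K E2'; in the other, S K F' = S V
    K = E2 K. These are the blocks of [K] itself. *)
Lemma intertwine_frob : (E1 *m F + S) *m K *m (E1' *m F' + S') = K.
Proof.
have h1 : E1 *m F *m K *m (E1' *m F') = 0.
  by rewrite (fit_E1F fit) -!mulmxA (mulmxA K) (mulmxA E1) (mulmxA E1) intertwine11 mul0mx mulmx0.
have h2 : E1 *m F *m K *m S' = E1 *m K *m E2'.
  by rewrite -(mulmxA E1) FK -!mulmxA (fit_VS fit').
have h3 : S *m K *m (E1' *m F') = E2 *m K *m E1'.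
  by rewrite (fit_E1F fit') mulmxA -(mulmxA S) -VK mulmxA (fit_SV fit).
have h4 : S *m K *m S' = 0.
  by rewrite -(fit_SE2 fit) -(fit_E2S fit') -!mulmxA (mulmxA K) (mulmxA E2) (mulmxA E2) intertwine22 mul0mx mulmx0.
rewrite !mulmxDl !mulmxDr h1 h2 h3 h4 add0r addr0 -[RHS]mul1mx -(fit_add fit) mulmxDl.
rewrite -[E1 *m K in RHS]mulmx1 -[E2 *m K in RHS]mulmx1 -(fit_add fit') !mulmxDr.
by rewrite intertwine11 intertwine22 add0r addr0.
Qed.
End Intertwine.
End FittingSplitting.

(** * The splitting and the semilinear operators as matrices *)

Section Operators.
Variables (p : nat) (p_pr : prime p) (kbar : closedFieldType).
Hypothesis chK : p \in [pchar kbar].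
Local Notation W := (witt p_pr kbar).
Variable m : nat.
Implicit Types (x y : 'rV[W]_m) (A B M : 'M[W]_m).

Lemma additive_tensor (h : 'rV[W]_m -> 'rV[W]_m) (g : W -> W) (E1 E2 A B : 'M[W]_m) :
  {morph h : x y / x + y} -> E1 + E2 = 1%:M ->
  (forall i w, h (w *: row i E1) = g w *: row i A) ->
  (forall i w, h (w *: row i E2) = g w *: row i B) ->
  forall x, h x = map_mx g x *m (A + B).
Proof.
move=> hD E12 h1 h2 x.
have h0 : h 0 = 0 by apply: (addrI (h 0)); rewrite -hD !addr0.
rewrite -[x in LHS]mulmx1 -E12 mulmxDr hD mulmxDr !mulmx_sum_row !(big_morph h hD h0).
by congr (_ + _); apply: eq_bigr => i _; rewrite ?h1 ?h2 mxE.
Qed.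

Lemma Zp_submodule_mulmx (S : 'rV[W]_m -> Prop) n (x : 'rV[W]_n) (A : 'M[W]_(n, m)) :
  Zp_submodule S -> (forall i, Zp_in_W (x 0 i)) -> (forall i, S (row i A)) -> S (x *m A).
Proof.
move=> [_ S0 SD SZ] hx hA; rewrite mulmx_sum_row.
by elim/big_ind : _ => // i _; exact: SZ.
Qed.

Lemma Zp_in_W_int (z : int) : Zp_in_W (z%:~R : W).
Proof.
have [phi hphi] := wfrob_iter_morph p_pr chK 1.
by apply/Zp_in_WE; rewrite -[wfrob _]hphi rmorph_int.
Qed.

Section Splitting.
Variables (a : nat) (F V : 'M[int]_m).
Local Notation FW := (map_mx intr F : 'M[W]_m).
Local Notation VW := (map_mx intr V : 'M[W]_m).
Variables (T1 T2 : 'rV[W]_m -> Prop).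
Hypothesis FV : F *m V = (p ^ a)%:R%:M.
Hypothesis VF : V *m F = (p ^ a)%:R%:M.
Hypothesis split : unit_splitting a F T1 T2.
Hypothesis torsfree : forall x : W, x *+ p ^ a = 0 -> x = 0.

(** Rows of [E1] and [E2] are the components of the standard basis vectors; rows of [Y] are
    preimages under F taken in T1, and rows of [S] quotients by q taken in T2. *)
Lemma splitting_projections : exists E1 E2 Y S : 'M[W]_m,
  [/\ fitting_splitting (p ^ a) FW VW E1 E2 Y S,
      forall i, T1 (row i E1), forall i, T2 (row i E2),
      forall i, T2 (row i S) & E2 *m FW = S *+ p ^ a].
Proof.
have [sub1 sub2] := (split_sub1 split, split_sub2 split).
have hE i : exists e : 'rV[W]_m * 'rV[W]_m,
    [/\ T1 e.1, T2 e.2 & row i (1%:M : 'M[W]_m) = e.1 + e.2].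
  have [j|e1 [e2 [h1 h2 h]]] := split_sum split (x := row i 1%:M).
    by rewrite !mxE -mulrz_nat; exact: Zp_in_W_int.
  by exists (e1, e2).
have [e he] := fin_all_exists hE.
pose E1 := \matrix_i (e i).1; pose E2 := \matrix_i (e i).2.
have T1E1 i : T1 (row i E1) by rewrite rowK; case: (he i).
have T2E2 i : T2 (row i E2) by rewrite rowK; case: (he i).
have E12 : E1 + E2 = 1%:M.
  by apply/row_matrixP => i; rewrite linearD /= !rowK; case: (he i).
have [y hy] := fin_all_exists (fun i => split_unit split (T1E1 i)).
pose Y := \matrix_i y i.
have T1Y i : T1 (row i Y) by rewrite rowK; case: (hy i) => -[].
have YF : Y *m FW = E1.
  by apply/row_matrixP => i; rewrite row_mul rowK; case: (hy i) => -[].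
have hs i : exists s, T2 s /\ row i E2 *m FW = s *+ p ^ a.
  by have [s h1 h2] := split_div split (T2E2 i); exists s.
have [s {}hs] := fin_all_exists hs.
pose S := \matrix_i s i.
have T2S i : T2 (row i S) by rewrite rowK; case: (hs i).
have E2F : E2 *m FW = S *+ p ^ a.
  apply/row_matrixP => i; rewrite row_mul; case: (hs i) => _ ->.
  by rewrite raddfMn /= rowK.
have projT x : x *m E2 = x - x *m E1.
  by rewrite -{2}[x]mulmx1 -E12 mulmxDr addrC addKr.
have Zp_opp (T : 'rV[W]_m -> Prop) t : Zp_submodule T -> T t -> T (- t).
  move=> [_ _ _ TZ] Tt; rewrite -scaleN1r; apply: TZ => //.
  exact: (Zp_in_W_int (-1)).
(* The vector t - t E1 = t E2 lies in both T1 and T2. *)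
have T1E t : T1 t -> t *m E1 = t.
  move=> T1t; have [Zpt _ _ _] := sub1.
  apply/esym/eqP; rewrite -subr_eq0 -projT; apply/eqP.
  apply: (split_direct split); last first.
    by apply: Zp_submodule_mulmx => // i; exact: Zpt.
  rewrite projT; have [_ _ T1D _] := sub1; apply: T1D => //.
  by apply: Zp_opp => //; apply: Zp_submodule_mulmx => // i; exact: Zpt.
have T2E t : T2 t -> t *m E1 = 0.
  move=> T2t; have [Zpt _ _ _] := sub2.
  apply: (split_direct split); first by apply: Zp_submodule_mulmx => // i; exact: Zpt.
  have -> : t *m E1 = t - t *m E2 by rewrite projT opprB addrC subrK.
  have [_ _ T2D _] := sub2; apply: T2D => //.
  by apply: Zp_opp => //; apply: Zp_submodule_mulmx => // i; exact: Zpt.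
have rowE1 A : (forall i, T1 (row i A)) -> A *m E1 = A.
  by move=> h; apply/row_matrixP => i; rewrite row_mul T1E.
exists E1, E2, Y, S; split=> //; apply: fitting_intro => //.
- by rewrite -map_mxM FV map_scalar_mx /= rmorph_nat.
- by rewrite -map_mxM VF map_scalar_mx /= rmorph_nat.
(* E1 F has rows in T1, fixed by E1, and E2 F has rows in T2, killed by E1. *)
- rewrite -[FW in RHS]mul1mx -E12 !mulmxDl rowE1 => [|i]; last first.
    by rewrite row_mul; apply: (split_stable1 split).
  rewrite [X in _ = _ + X](_ : _ = 0) ?addr0 //; apply/row_matrixP => i.
  rewrite !row_mul row0; apply: T2E; exact: (split_stable2 split).
- exact: rowE1.
Qed.
End Splitting.

Lemma map_iter_wfrobM a n1 n2 n3 (A : 'M[W]_(n1, n2)) (B : 'M[W]_(n2, n3)) :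
  map_mx (iter a (@wfrob _ _ _)) (A *m B) =
  map_mx (iter a (@wfrob _ _ _)) A *m map_mx (iter a (@wfrob _ _ _)) B.
Proof.
have [phi hphi] := wfrob_iter_morph p_pr chK a.
by rewrite -!(eq_map_mx _ hphi) map_mxM.
Qed.

Lemma map_iter_wfrob_fix a n1 n2 (A : 'M[W]_(n1, n2)) :
  (forall i j, Zp_in_W (A i j)) -> map_mx (iter a (@wfrob _ _ _)) A = A.
Proof. by move=> h; apply/matrixP => i j; rewrite mxE Zp_iter_wfrob. Qed.

Lemma map_iter_wfrob_int a n1 n2 (A : 'M[int]_(n1, n2)) :
  map_mx (iter a (@wfrob _ _ _)) (map_mx intr A) = map_mx intr A :> 'M[W]_(n1, n2).
Proof. by apply: map_iter_wfrob_fix => i j; rewrite mxE; exact: Zp_in_W_int. Qed.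

Lemma map_iter_wfrobX b M a : map_mx (iter b (@wfrob _ _ _)) M = M ->
  map_mx (iter b (@wfrob _ _ _)) (M ^+ a) = M ^+ a.
Proof.
move=> hM; elim: a => [|a IH]; last by rewrite exprSr map_iter_wfrobM IH hM.
apply: map_iter_wfrob_fix => i j.
by rewrite mxE -mulrz_nat; exact: Zp_in_W_int.
Qed.

Lemma exp_mx_intertwine M M' B a : M *m B = B *m M' ->
  M ^+ a *m B = B *m M' ^+ a.
Proof.
move=> h; elim: a => [|a IH]; first by rewrite mul1mx mulmx1.
by rewrite !exprSr -!mulmxE -mulmxA h !mulmxA IH.
Qed.

Lemma iter_wfrob_linear (h : 'rV[W]_m -> 'rV[W]_m) M a :
  (forall x, h x = map_mx (@wfrob _ _ _) x *m M) -> map_mx (@wfrob _ _ _) M = M ->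
  forall x, iter a h x = map_mx (iter a (@wfrob _ _ _)) x *m M ^+ a.
Proof.
move=> hM fixM x; elim: a => [|a IH].
  by rewrite /= mulmx1; apply/matrixP => i j; rewrite mxE.
rewrite [LHS]/= IH hM (map_iter_wfrobM 1) (map_iter_wfrobX (b := 1)) // exprSr -mulmxE mulmxA.
by congr (_ *m _ *m _); apply/matrixP => i j; rewrite !mxE.
Qed.

(** Applying the Frobenius to both sides expresses an inverse-Frobenius semilinear map through the
    Frobenius alone. *)
Lemma iter_wfrob_inv_linear (h : 'rV[W]_m -> 'rV[W]_m) M a :
  (forall x, map_mx (@wfrob _ _ _) (h x) = x *m M) ->
  (forall b, map_mx (iter b (@wfrob _ _ _)) M = M) ->
  forall x, map_mx (iter a (@wfrob _ _ _)) (iter a h x) = x *m M ^+ a.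
Proof.
move=> hM fixM x; elim: a => [|a IH].
  by rewrite /= mulmx1; apply/matrixP => i j; rewrite mxE.
transitivity (map_mx (iter a (@wfrob _ _ _)) (map_mx (@wfrob _ _ _) (h (iter a h x)))).
  by apply/matrixP => i j; rewrite !mxE iterSr.
by rewrite hM map_iter_wfrobM fixM IH exprSr -mulmxE -mulmxA.
Qed.
End Operators.

Lemma bform_inj (S : pzRingType) m (A B : 'M[S]_m) :
  (forall x y, bform A x y = bform B x y) -> A = B.
Proof.
move=> h; apply/matrixP => i j; have := h (delta_mx 0 i) (delta_mx 0 j).
by rewrite /bform !trmx_delta -!rowE -!colE !mxE.
Qed.

Lemma bform_mulmx (S : comPzRingType) m (A B C : 'M[S]_m) x y :
  bform A (x *m B) (y *m C) = bform (B *m A *m C^T) x y.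
Proof. by rewrite /bform trmx_mul !mulmxA. Qed.

(** Since G preserves B, inserting G B G^T for B lowers the left index by one and raises the right
    one. *)
Lemma bilinear_shift (S : comPzRingType) m (X Z : nat -> 'rV[S]_m) (G B : 'M[S]_m) :
  (forall i, X i.+1 *m G = X i) -> (forall j, Z j.+1 = Z j *m G) ->
  G *m B *m G^T = B ->
  forall i j, X i *m B *m (Z j)^T = X 0 *m B *m (Z (i + j)%N)^T.
Proof.
move=> XG ZG GB; elim=> // i IH j; rewrite addSnnS -IH ZG trmx_mul -(XG i).
by rewrite -[in LHS]GB !mulmxA.
Qed.

Lemma additiveMn (U U' : nmodType) (f : U -> U') : f 0 = 0 -> {morph f : x y / x + y} ->
  forall x n, f (x *+ n) = f x *+ n.
Proof. by move=> f0 fD x; elim=> [|n IH]; rewrite ?mulr0n // !mulrS fD IH. Qed.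

Theorem proposition11p2
  (p a n : nat) (p_pr : prime p)
  (* k = F_q with q = p^a, and an algebraic closure of k *)
  (k : finFieldType) (kbar : closedFieldType) (iota : {rmorphism k -> kbar})
  (card_k : #|k| = (p ^ a)%N)
  (kbar_algebraic : forall x, algebraicOver iota x)
  (* the embedding epsilon of W(kbar) in C, and val_p *)
  (R : realType) (eps : {rmorphism witt p_pr kbar -> R[i]})
  (eps_inj : injective eps)
  (val : R[i] -> rat) (val_eps : is_valp eps val)
  (* the polarized Deligne module with real structure *)
  (F V omega tau : 'M[int]_(2 * n))
  (TF : deligne_module val p a F V)
  (pol : polarization val F V omega)
  (real : real_structure F V omega tau)
  (* T (x) Z_p = T1 (+) T2 and the operators on T (x) W(kbar) *)
  (T1 T2 : 'rV[witt p_pr kbar]_(2 * n) -> Prop)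
  (split : unit_splitting a F T1 T2)
  (pi Fr Ve : 'rV[witt p_pr kbar]_(2 * n) -> 'rV[witt p_pr kbar]_(2 * n))
  (pi_def : is_galois_generator a F T1 T2 pi)
  (Fr_def : is_dieudonne_F T1 T2 Fr)
  (Ve_def : is_dieudonne_V T1 T2 Ve)
  (taubar : witt p_pr kbar -> witt p_pr kbar)
  (taubar_def : is_taubar iota a taubar) :
  [/\ padic_continuous p (tau_p tau taubar),
      (forall (c : witt p_pr kbar) (x y : 'rV[witt p_pr kbar]_(2 * n)),
         W_of_k iota c ->
         tau_p tau taubar (c *: x + y) =
         c *: tau_p tau taubar x + tau_p tau taubar y),
      (forall x, dieudonne_module pi x -> dieudonne_module pi (tau_p tau taubar x)),
      (forall x, tau_p tau taubar (iter a Fr x) = iter a Ve (tau_p tau taubar x)) &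
      (forall x y, dieudonne_module pi x -> dieudonne_module pi y ->
         omega_p omega (tau_p tau taubar x) (tau_p tau taubar y) =
         - omega_p omega x y)].
Proof.
set W := witt p_pr kbar.
have chK : p \in [pchar kbar].
  by rewrite (fmorph_pchar iota); exact: card_finPcharP card_k p_pr.
have a_gt0 : (0 < a)%N.
  by rewrite lt0n; apply: contraTneq (finNzRing_gt1 k) => a0; rewrite card_k a0.
(* W embeds in a field by [eps]. *)
have domW : GRing.integral_domain_axiom W.
  move=> u v /(congr1 eps); rewrite rmorphM rmorph0 => /eqP.
  by rewrite mulf_eq0 -(rmorph0 eps) !(inj_eq eps_inj).
have torsW (u : W) : u *+ p ^ a = 0 -> u = 0 by exact: (witt_mulpX_eq0 chK).
(* As a is positive, p^l divides q^l. *)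
have sepW (u : W) : (forall l, exists z, u = z *+ (p ^ a) ^ l) -> u = 0.
  move=> h; apply: (witt_separated chK) => l; have [z ->] := h l.
  exists (z *+ p ^ (a * l - l)).
  by rewrite -mulrnA -expnM -expnD subnK // leq_pmull.
pose phi := iter a (@wfrob p p_pr kbar).
have [phiM phiE] := wfrob_iter_morph p_pr chK a.
have phi_inj : injective phi by exact: wfrob_iter_inj.

(* The splitting, and how [tau] and [omega] exchange F and V *)
have [FV VF] := (deligne_FV TF, deligne_VF TF).
pose FW : 'M[W]_(2 * n) := map_mx intr F; pose VW : 'M[W]_(2 * n) := map_mx intr V.
pose tW : 'M[W]_(2 * n) := map_mx intr tau; pose oW : 'M[W]_(2 * n) := map_mx intr omega.
have [E1 [E2 [Y [S [fit T1E1 T2E2 T2S E2F]]]]] :=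
  splitting_projections chK FV VF split torsW.
have tt := real_invol real.
have Ft : F *m tau = tau *m V.
  have tU : tau \in unitmx by case/mulmx1_unit: tt.
  by rewrite -(real_FV real) !mulmxA mulmxV // mul1mx.
have Vt : V *m tau = tau *m F.
  by rewrite -[LHS]mul1mx -tt -!mulmxA (mulmxA tau V) -Ft -mulmxA tt mulmx1.
have FtW : FW *m tW = tW *m VW by rewrite -!map_mxM Ft.
have VtW : VW *m tW = tW *m FW by rewrite -!map_mxM Vt.
have Fo : F *m omega = omega *m V^T.
  apply: bform_inj => x y; have := pol_FV pol x y.
  by rewrite -{1}[y]mulmx1 -{1}[x in RHS]mulmx1 !bform_mulmx trmx1 mulmx1 mul1mx.
have FoW : FW *m oW = oW *m VW^T by rewrite map_trmx -!map_mxM Fo.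
(* Follows from [FoW] after multiplication by q, written V F on the left and F V on the right. *)
have VoW : VW *m oW = oW *m FW^T.
  apply: (mx_torsfree torsW); rewrite -mulmx_q.
  rewrite -[RHS]mul_q_mx -[X in _ = X *m _](fit_VF fit) -!mulmxA (mulmxA FW) FoW -!mulmxA -trmx_mul.
  by rewrite (fit_FV fit) tr_scalar_mx.
have fitT := fitting_tr fit.
pose G := E1 *m FW + S.
have GtG : G *m tW *m G = tW := intertwine_frob sepW fit fit FtW VtW.
have GoG : G *m oW *m G^T = oW.
  rewrite -[RHS](intertwine_frob sepW fit fitT FoW VoW); congr (_ *m _).
  by rewrite /G (fit_E1F fit) linearD /= trmx_mul.
have oto : tW *m oW *m tW^T = - oW.
  rewrite map_trmx -!map_mxM -map_mxN; congr map_mx; apply: bform_inj => x y.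
  by rewrite -bform_mulmx (real_omega real) /bform mulmxN mulNmx [RHS]mxE.

(* Semilinearity of [taubar] *)
have [tbD tbK] := (taubarD taubar_def, taubarK taubar_def).
have tb0 : taubar 0 = 0 by apply: (addrI (taubar 0)); rewrite -tbD !addr0.
have tbZ c u : phi c = c -> taubar (c * u) = c * taubar u.
  by move=> h; apply: (taubarZ taubar_def); apply/(W_of_kE _ _ card_k).
(* The relation taubar phi = phi^-1 taubar, with the inverse cleared. *)
have tbphi u : phi (taubar (phi u)) = taubar u.
  by rewrite (taubar_frob taubar_def) /phi iter_wfrob_invK.
have tbM n1 n2 n3 (A : 'M[W]_(n1, n2)) (B : 'M_(n2, n3)) : map_mx phi B = B ->
    map_mx taubar (A *m B) = map_mx taubar A *m B.
  move=> /matrixP fixB; apply/matrixP => i j; rewrite !mxE (big_morph _ tbD tb0).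
  apply: eq_bigr => l _; have := fixB l j; rewrite !mxE => h.
  by rewrite mulrC tbZ // mulrC.
have tbphi_mx n1 n2 (A : 'M[W]_(n1, n2)) :
    map_mx phi (map_mx taubar (map_mx phi A)) = map_mx taubar A.
  by apply/matrixP => i j; rewrite !mxE tbphi.
have tpD := tau_pD tau tbD.
have tp0 : tau_p tau taubar 0 = 0.
  by apply: (addrI (tau_p tau taubar 0)); rewrite -tpD !addr0.

(* Matrices of [pi], [Fr] and [Ve] *)
have ZpE1 i j : Zp_in_W (E1 i j).
  by have [Zp _ _ _] := split_sub1 split; have := Zp _ (T1E1 i) j; rewrite mxE.
have ZpE2 i j : Zp_in_W (E2 i j).
  by have [Zp _ _ _] := split_sub2 split; have := Zp _ (T2E2 i) j; rewrite mxE.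
have ZpS i j : Zp_in_W (S i j).
  by have [Zp _ _ _] := split_sub2 split; have := Zp _ (T2S i) j; rewrite mxE.
have fixE1 b : map_mx (iter b (@wfrob _ _ _)) E1 = E1 by exact: map_iter_wfrob_fix.
have fixE2 b : map_mx (iter b (@wfrob _ _ _)) E2 = E2 by exact: map_iter_wfrob_fix.
have fixD b (A B : 'M[W]_(2 * n)) : map_mx (iter b (@wfrob _ _ _)) A = A ->
    map_mx (iter b (@wfrob _ _ _)) B = B -> map_mx (iter b (@wfrob _ _ _)) (A + B) = A + B.
  move=> hA hB; have [psi hpsi] := wfrob_iter_morph p_pr chK b.
  by rewrite -(eq_map_mx _ hpsi) map_mxD !(eq_map_mx _ hpsi) hA hB.
have fixMn b l (A : 'M[W]_(2 * n)) : map_mx (iter b (@wfrob _ _ _)) A = A ->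
    map_mx (iter b (@wfrob _ _ _)) (A *+ l) = A *+ l.
  move=> hA; elim: l => [|l IH]; last by rewrite mulrS fixD.
  by apply: map_iter_wfrob_fix => i j; rewrite mulr0n mxE; exact: (Zp_in_W_int p_pr chK 0).
have fixG : map_mx phi G = G.
  apply: fixD; last exact: map_iter_wfrob_fix.
  by rewrite /phi map_iter_wfrobM // fixE1 map_iter_wfrob_int.
have piE x : pi x = map_mx phi x *m G.
  apply: (additive_tensor (pi_additive pi_def) (fit_add fit)) => i w.
    by rewrite (pi_T1 pi_def) // row_mul.
  apply: (pi_T2 pi_def) => //.
  by rewrite -row_mul E2F raddfMn.
pose MF := E1 *+ p + E2; pose MV := E1 + E2 *+ p.
have FrE x : Fr x = map_mx (@wfrob _ _ _) x *m MF.
  apply: (additive_tensor (dieuF_additive Fr_def) (fit_add fit)) => i w.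
    by rewrite (dieuF_T1 Fr_def) //; congr (_ *: _); rewrite raddfMn.
  exact: (dieuF_T2 Fr_def).
have VeE x : map_mx (@wfrob _ _ _) (Ve x) = x *m MV.
  have -> : Ve x = map_mx (@wfrob_inv _ _ _) x *m MV.
    apply: (additive_tensor (dieuV_additive Ve_def) (fit_add fit)) => i w.
      exact: (dieuV_T1 Ve_def).
    by rewrite (dieuV_T2 Ve_def) //; congr (_ *: _); rewrite raddfMn.
  rewrite (map_iter_wfrobM chK 1) (fixD 1) ?fixMn //; congr (_ *m _).
  by apply/matrixP => i j; rewrite !mxE /= wfrob_invK.
(* [tau] exchanges the projections E1 and E2, hence the factors p and 1. *)
have MFt : MF *m tW = tW *m MV.
  rewrite mulmxDl mulmxDr mulqmx mulmxq addrC.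
  rewrite (intertwine21 sepW fit fit FtW VtW).
  by rewrite (intertwine12 sepW fit fit FtW VtW).
(* [taubar] reverses direction: x = phi(x) G becomes phi(taubar x) = taubar(x) G. *)
have tpM x : dieudonne_module pi x -> map_mx phi (map_mx taubar x) = map_mx taubar x *m G.
  rewrite /dieudonne_module piE => Mx.
  have -> : map_mx taubar x = map_mx taubar (map_mx phi x) *m G by rewrite -tbM // Mx.
  rewrite map_iter_wfrobM // fixG tbphi_mx; congr (_ *m _).
  by rewrite -tbM // Mx.
have iterE j (u : W) : iter j phiM u = iter (j * a)%N (@wfrob _ _ _) u.
  by elim: j => // j IH; rewrite /= IH phiE mulSn iterD.
split.
- move=> x N; exists N => y [z /eqP]; rewrite subr_eq addrC => /eqP ->.
  by exists (tau_p tau taubar z); rewrite tpD addrAC subrr add0r additiveMn.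
- move=> c x y kc; rewrite tpD; congr (_ + _); rewrite /tau_p scalemxAl; congr (_ *m _).
  by apply/matrixP => i j; rewrite !mxE (taubarZ taubar_def).
(* By [tpM] and [GtG], phi(taubar x) tau G = taubar(x) G tau G = taubar(x) tau. *)
- move=> x Mx; rewrite /dieudonne_module piE /tau_p map_iter_wfrobM //.
  by rewrite tpM // map_iter_wfrob_int // -[RHS](congr1 (mulmx _) GtG) !mulmxA.
(* Applying the injective phi removes the inverse Frobenius from Ve^a. *)
- move=> x; suff : map_mx phi (tau_p tau taubar (iter a Fr x)) =
                   map_mx phi (iter a Ve (tau_p tau taubar x)).
    by move=> /matrixP h; apply/matrixP => i j; have := h i j; rewrite !mxE => /phi_inj.
  rewrite (iter_wfrob_inv_linear chK a VeE) => [|b]; last by rewrite fixD ?fixMn.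
  have fixMF b : map_mx (iter b (@wfrob _ _ _)) MF = MF by rewrite fixD ?fixMn.
  rewrite (iter_wfrob_linear chK a FrE) ?(fixMF 1) // /tau_p tbM ?map_iter_wfrobX //.
  rewrite !map_iter_wfrobM // tbphi_mx map_iter_wfrobX // map_iter_wfrob_int //.
  by rewrite -!mulmxA (exp_mx_intertwine a MFt).
(* [oto] gives the sign. It remains to move [taubar] from x to w = omega taubar(y)^T. *)
- move=> x y Mx My; rewrite /omega_p /tau_p bform_mulmx oto /bform mulmxN mulNmx mxE.
  congr (- _).
  set z := map_mx taubar y.
  have zG : map_mx phi z = z *m G by exact: tpM.
  have xG : map_mx phi x *m G = x by rewrite -piE.
  pose P j := iter (j * a)%N (@wfrob p p_pr kbar).
  have PS j n1 n2 (A : 'M[W]_(n1, n2)) : map_mx (P j.+1) A = map_mx (P j) (map_mx phi A).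
    by apply/matrixP => i l; rewrite !mxE /P mulSn addnC iterD.
  have fixPG j : map_mx (P j) G = G.
    apply: fixD; last exact: map_iter_wfrob_fix.
    by rewrite map_iter_wfrobM // fixE1 map_iter_wfrob_int.
  have xPS i : map_mx (P i.+1) x *m G = map_mx (P i) x.
    rewrite -[in RHS]xG PS -[X in _ *m X = _](fixPG i) /P.
    by rewrite -(map_iter_wfrobM chK (i * a)%N).
  have zPS j : map_mx (P j.+1) z = map_mx (P j) z *m G.
    by rewrite PS zG {1}/P (map_iter_wfrobM chK (j * a)%N) (fixPG j).
  have shift i j : map_mx (P i) x *m oW *m (map_mx (P j) z)^T =
                   map_mx (P 0) x *m oW *m (map_mx (P (i + j)%N) z)^T :=
    bilinear_shift (X := fun i => map_mx (P i) x) (Z := fun j => map_mx (P j) z)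
      xPS zPS GoG i j.
  pose w := oW *m z^T.
  have iterw i j : \sum_l iter i phiM (x 0 l) * iter j phiM (w l 0) =
      (map_mx (P i) x *m oW *m (map_mx (P j) z)^T) 0 0.
    rewrite -mulmxA -[oW](map_iter_wfrob_int p_pr chK (j * a)%N) map_trmx -map_iter_wfrobM //.
    by rewrite mxE; apply: eq_bigr => l _; rewrite !iterE [in RHS]mxE [in RHS]mxE.
  (* [taubar] is an involution and commutes with the integer matrix [omega]. *)
  have tbw : map_mx taubar w = oW *m y^T.
    rewrite -[w]trmxK -map_trmx trmx_mul trmxK tbM.
      rewrite trmx_mul trmxK; congr (_ *m _^T).
      by apply/matrixP => i j; rewrite !mxE tbK.
    by rewrite map_trmx; exact: map_iter_wfrob_int.
  have := @semilinear_swap W phiM domW _ _ taubar _ (fun l => x 0 l) (fun l => w l 0) tbD.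
  move=> swap; rewrite -!mulmxA [LHS]mxE [RHS]mxE.
  transitivity (\sum_l taubar (x 0 l) * w l 0); first by apply: eq_bigr => l _; rewrite mxE.
  rewrite swap.
  + by apply: eq_bigr => l _; congr (_ * _); rewrite -tbw [RHS]mxE.
  + by move=> u v; rewrite !phiE; exact: phi_inj.
  + exact: witt_fix_frac.
  + by move=> c u; rewrite phiE; exact: tbZ.
  (* By [shift], both sides depend only on i + j. *)
  + by move=> i j; rewrite !iterw (shift i j) (shift j i) addnC.
Qed.
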